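(* Let $(\mathsf{X},\mathcal{X})$ be a Polish space with its Borel $\sigma$-field and let $\pi$ be a density with respect to a measure $\mu$ on $(\mathsf{X},\mathcal{X})$ such that $\pi$ is continuous and positive on $\mathsf{X}$ and $\|\pi\|_\infty<+\infty$. Choose $T_\star>1$ and $T_1=1<T_2<\cdots<T_K<T_\star$. Assume that for any $i\in\{1,\dots,K-1\}$ there exists a $\pi$-irreducible Feller transition kernel $P^{(i)}$ on $(\mathsf{X},\mathcal{X})$ such that: (i) $\pi^{1/T_i}P^{(i)}=\pi^{1/T_i}$; (ii) for any $s\in(0,1/T_i)$ there exist $\lambda^{(i)}\in(0,1)$ and $b^{(i)}<+\infty$ such that $P^{(i)}U_s\le\lambda^{(i)}U_s+b^{(i)}$, where $U_s\propto\pi^{-s}$. Let $\{X^{(i)}_n,n\ge0\}$, $i=1,\dots,K$, be the processes of the $K$-stage interacting tempering algorithm described in the context. Assume in addition that there exists $\tilde T\in(T_K,T_\star)$ such that: (iii) $\int\pi^{1/T_K-1/\tilde T}\,d\mu<+\infty$; (iv) for any continuous function $f$ with $\sup_x|f(x)|\pi^{1/\tilde T}(x)<\infty$, $$n^{-1}\sum_{k=1}^nf(X^{(K)}_k)\to\int f\,\frac{\pi^{1/T_K}}{\int\pi^{1/T_K}\,d\mu}\,d\mu\quad\text{a.s.};$$ (v) $\sup_n\mathbb{E}[\pi^{-1/\tilde T}(X^{(K)}_n)]<\infty$. Finally, assume that for any $i\in\{1,\dots,K-1\}$, $\mathbb{E}[\pi^{-1/\tilde T}(X^{(i)}_0)]<+\infty$.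 Then for any continuous function $f$ with $\sup_x|f(x)|\pi^{1/T_\star}(x)<\infty$, $$n^{-1}\sum_{k=1}^nf(X^{(1)}_k)\to\int f\,\pi\,d\mu\quad\text{a.s.}$$
   Context: $K$-stage interacting tempering algorithm: fix $\upsilon\in(0,1)$. $X^{(K)}=\{X^{(K)}_n\}$ is a given $\mathsf{X}$-valued process. For $k=K-1,\dots,1$, the process $X^{(k)}$ is defined from $X^{(k+1)}$: given the past of $X^{(k+1)}$ up to time $n$ and the current value $X^{(k)}_n$, the state $X^{(k)}_{n+1}$ is obtained as follows. With probability $1-\upsilon$, $X^{(k)}_{n+1}$ is sampled from $P^{(k)}(X^{(k)}_n,\cdot)$. With probability $\upsilon$, a tentative state $Z_{n+1}$ is drawn uniformly at random from the past $\{X^{(k+1)}_\ell,0\le\ell\le n\}$, and the move $X^{(k)}_{n+1}=Z_{n+1}$ is accepted with probability $1\wedge\big(\pi(X^{(k)}_n)/\pi(Z_{n+1})\big)^{T_{k+1}^{-1}-T_k^{-1}}$; otherwise $X^{(k)}_{n+1}=X^{(k)}_n$. The equality in (i) means that the distribution with density (with respect to $\mu$) proportional to $\pi^{1/T_i}$ is invariant for $P^{(i)}$. A kernel is Feller if it maps bounded continuous functions to bounded continuous functions. $\|\cdot\|_\infty$ is the supremum norm. *)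

(* Defs.v *)
From HB Require Import structures.
From mathcomp Require Import all_boot all_order all_algebra.
From mathcomp Require Import all_classical all_reals all_analysis.

Set Implicit Arguments.
Unset Strict Implicit.
Unset Printing Implicit Defensive.

Import Order.TTheory GRing.Theory Num.Theory.
Import numFieldNormedType.Exports.

Local Open Scope classical_set_scope.
Local Open Scope ring_scope.

Definition separable (X : topologicalType) : Prop :=
  exists2 D : set X, countable D & dense D.

Definition completely_metrizable (R : realType) (X : topologicalType) : Prop :=
  exists d : X -> X -> R,
    [/\ [/\ forall x, d x x = 0,
            forall x y, d x y = 0 -> x = y,
            forall x y, d x y = d y x
          & forall x y z, d x z <= d x y + d y z],
        forall (x : X) (A : set X),
          nbhs x A <-> exists2 e : R, 0 < e & [set y | d x y < e] `<=` A
      & forall u : nat -> X,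
          (forall e : R, 0 < e ->
             exists N : nat, forall m n : nat,
               (N <= m)%N -> (N <= n)%N -> d (u m) (u n) < e) ->
          exists l : X, u @ \oo --> l].

Definition polish (R : realType) (X : topologicalType) : Prop :=
  separable X /\ completely_metrizable R X.

Notation borel X := (g_sigma_algebraType (@open X)).

Definition sup_norm (R : realType) (T : Type) (f : T -> R) : \bar R :=
  ereal_sup (range (fun x => `|f x|%:E)).

Definition density (R : realType) (d : measure_display) (T : measurableType d)
    (mu : {measure set T -> \bar R}) (g : T -> R) : Prop :=
  [/\ measurable_fun setT g, forall x, 0 <= g x & (\int[mu]_x (g x)%:E = 1)%E].

Section markov_kernels.
Context (R : realType) (d : measure_display) (T : measurableType d).
Implicit Type P : R.-pker T ~> T.

Fixpoint kernel_iter P (n : nat) (x : T) (A : set T) : \bar R :=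
  if n is m.+1 then (\int[P x]_y kernel_iter P m y A)%E else \d_x A.

(* Irreducibility with respect to the measure of density g against mu. *)
Definition irreducible_kernel (mu : {measure set T -> \bar R}) (g : T -> R) P :
    Prop :=
  forall (x : T) (A : set T), measurable A ->
    (0 < \int[mu]_(y in A) (g y)%:E)%E ->
    exists n : nat, (0 < kernel_iter P n.+1 x A)%E.

(* Invariance of the measure of density g against mu. *)
Definition invariant_density (mu : {measure set T -> \bar R}) (g : T -> R) P :
    Prop :=
  forall A : set T, measurable A ->
    (\int[mu]_x ((g x)%:E * P x A) = \int[mu]_(x in A) (g x)%:E)%E.

Definition drift_condition P (U : T -> R) : Prop :=
  exists lambda b : R, 0 < lambda < 1 /\
    forall x, (\int[P x]_y (U y)%:E <= (lambda * U x + b)%:E)%E.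

End markov_kernels.

Definition feller (R : realType) (X : ptopologicalType)
    (P : R.-pker borel X ~> borel X) : Prop :=
  forall f : X -> R, continuous f -> (sup_norm f < +oo)%E ->
    let Pf : X -> R := fun x => \int[P x]_y f y in
    continuous Pf /\ (sup_norm Pf < +oo)%E.

(* When the integral of pi ^ (1 / t) is infinite, Rintegral returns 0 and this
   is the zero function. *)
Definition tempered (R : realType) (d : measure_display) (T : measurableType d)
    (mu : {measure set T -> \bar R}) (pi : T -> R) (t : R) (x : T) : R :=
  pi x `^ t^-1 / \int[mu]_y (pi y `^ t^-1).

Section interacting_tempering.
Context (R : realType) (d : measure_display) (T : measurableType d).
Variables (upsilon : R) (P : nat -> R.-pker T ~> T) (pi : T -> R)
  (Temp : nat -> R).

Definition swap_acceptance (k : nat) (x z : T) : R :=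
  Num.min 1 ((pi x / pi z) `^ ((Temp k.+1)^-1 - (Temp k)^-1)).

(* Law of the state at level k and time n + 1, given that the state at time n
   is x and that level k + 1 has visited past 0, ..., past n. *)
Definition tempering_step (k n : nat) (past : nat -> T) (x : T) (A : set T) :
    \bar R :=
  ((1 - upsilon)%:E * P k x A +
   upsilon%:E * ((n.+1%:R^-1)%:E *
     \sum_(0 <= l < n.+1)
       ((swap_acceptance k x (past l))%:E * \d_(past l) A +
        (1 - swap_acceptance k x (past l))%:E * \d_x A)))%E.

Context (d' : measure_display) (Omega : measurableType d')
  (Pr : probability Omega R).
Implicit Type X : nat -> nat -> {RV Pr >-> T}.

Definition history X (k n : nat) : set (set Omega) :=
  <<s [set B | exists j l : nat, exists A : set T,
         [/\ (k <= j <= k.+1)%N, (l <= n)%N, measurable A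
           & B = X j l @^-1` A]] >>.

(* X k n is the state of level k at time n; only levels 1, ..., K matter.
   The integral identity says that tempering_step is a version of the
   conditional law of X k n.+1 given history X k n. *)
Definition interacting_tempering (K : nat) X : Prop :=
  forall k n : nat, (1 <= k < K)%N ->
    forall (B : set Omega) (A : set T), history X k n B -> measurable A ->
      (Pr (B `&` X k n.+1 @^-1` A) =
       \int[Pr]_(w in B)
         tempering_step k n (fun l => X k.+1 l w) (X k n w) A)%E.

End interacting_tempering.

(* Main.v *)
Require Import Defs.
From HB Require Import structures.
From mathcomp Require Import all_boot all_order all_algebra.
From mathcomp Require Import finmap.
From mathcomp Require Import all_classical all_reals all_analysis.
From mathcomp Require Import measurable_realfun simple_functions zify lra ring.

Set Implicit Arguments.
Unset Strict Implicit.
Unset Printing Implicit Defensive.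

Import Order.TTheory GRing.Theory Num.Theory.
Import numFieldNormedType.Exports.

Local Open Scope classical_set_scope.
Local Open Scope ring_scope.

(** The levels are treated from the hottest one, [K], down to [1]. Write [X] for
    the process at level [k], [Y] for the one at level [k.+1], [p] and [q] for
    the corresponding tempered densities, and [theta_n] for the empirical
    measure of [Y] up to time [n]. Given the past, [X] moves by a mixture of the
    kernel [P k] and of a Metropolis-Hastings step that proposes from
    [theta_n]. If [theta_n] were the measure of density [q], this would be a
    fixed operator, [limit_op], which leaves the measure of density [p]
    invariant ([limit_op_invariant]).

    The estimate that carries the proof comes from the boundedness of [pi]: if
    [M] bounds [pi] and [b] is the difference of the inverse temperatures, a
    proposal [y] is accepted with probability at least [(pi y / M) `^ b],
    whatever the current state ([accept_lower]). So [limit_op] satisfies a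
    Doeblin minorisation on the whole space and contracts oscillations at a
    fixed rate ([swap_op_contract]). Its iterates preserve bounded continuous
    functions and converge uniformly to the mean under [p], hence finite sums
    of iterates are bounded continuous solutions of the Poisson equation up to
    a small uniform error ([poisson_equation]).

    For bounded continuous [f] and such a solution [F], the averages of [f]
    minus its mean under [p] become the sum of a martingale average, which
    vanishes by a second moment estimate along the squares ([mart_sum_lln]),
    and of the average of the errors made by replacing [theta_n] by its limit
    ([poisson_path]). The acceptance probability depends on the current state
    only through [pi], and in a Hoelder continuous way. Therefore the
    convergence of [theta_n] on countably many continuous functions, known
    from the upper level, makes these errors tend to 0 uniformly in the
    current state ([uniform_averaging_accept], [one_step_limit]).

    Unbounded functions are reached through the drift conditions. The moments
    of [pi `^ (- Ttilde^-1)] along [X] stay bounded ([moments_bounded]). For an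
    exponent [s'] between half of [Ttilde^-1] and [Ttilde^-1], truncation at
    dyadic levels and the same second moment estimate bound the averages of
    [pi `^ (- s')] almost surely ([average_bounded]). This weight controls the
    tails of any [f] dominated by [pi `^ (- s)] with [s < s'] ([lln_weighted]).
    The law of large numbers thus passes from level [k.+1] to level [k] for all
    exponents below [Ttilde^-1] ([level_step]), and at level [1] it covers the
    exponent [Tstar^-1]. *)

(** * Functionals determined by indicators *)

Section integral_like.
Context (R : realType) (d : measure_display) (T : measurableType d).
Implicit Types (f g : T -> \bar R) (Phi Psi : (T -> \bar R) -> \bar R).
Local Open Scope ereal_scope.

Definition nonneg_meas f := measurable_fun setT f /\ forall x, 0 <= f x.

(** The properties of the integral against a measure that the monotone class
    argument uses. Working with functionals avoids building a measure or a
    kernel for each expression that is linear in the integrand, such as the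
    mean of a tempered move. *)
Record integral_like Phi : Prop := IntegralLike {
  il_ge0 : forall f, nonneg_meas f -> 0 <= Phi f ;
  il_le : forall f g, nonneg_meas f -> nonneg_meas g ->
    (forall x, f x <= g x) -> Phi f <= Phi g ;
  ilD : forall f g, nonneg_meas f -> nonneg_meas g ->
    Phi (fun x => f x + g x) = Phi f + Phi g ;
  ilZ : forall (c : R) f, (0 <= c)%R -> nonneg_meas f ->
    Phi (fun x => c%:E * f x) = c%:E * Phi f ;
  il_cvg : forall (u : nat -> T -> \bar R), (forall n, nonneg_meas (u n)) ->
    (forall x, nondecreasing_seq (u ^~ x)) ->
    Phi (u n) @[n --> \oo] --> Phi (fun x => limn (u ^~ x)) }.

Lemma nonneg_measZ (c : R) f : (0 <= c)%R -> nonneg_meas f ->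
  nonneg_meas (fun x => c%:E * f x).
Proof.
move=> c0 [mf f0]; split; first exact: measurable_funeM.
by move=> x; rewrite mule_ge0.
Qed.

Lemma nonneg_meas_indic A : measurable A ->
  nonneg_meas (fun x => (\1_A x)%:E).
Proof.
move=> mA; split; last by move=> x; rewrite lee_fin.
by apply/measurable_EFinP; exact: measurable_indic.
Qed.

Lemma nonneg_meas_lim (u : nat -> T -> \bar R) :
  (forall n, nonneg_meas (u n)) -> (forall x, nondecreasing_seq (u ^~ x)) ->
  nonneg_meas (fun x => limn (u ^~ x)).
Proof.
move=> mu ndu; split.
  apply: (emeasurable_fun_cvg u); first by move=> n; exact: (mu n).1.
  by move=> x _; exact: ereal_nondecreasing_is_cvgn.
move=> x; apply: lime_ge; first exact: ereal_nondecreasing_is_cvgn.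
by apply: nearW => n; exact: (mu n).2.
Qed.

Import HBNNSimple.

(** Both functionals are additive, homogeneous and continuous along increasing
    sequences, so agreement passes from indicators to simple functions and then
    to their increasing limits. *)
Lemma integral_like_eq Phi Psi : integral_like Phi -> integral_like Psi ->
  (forall A, measurable A ->
    Phi (fun x => (\1_A x)%:E) = Psi (fun x => (\1_A x)%:E)) ->
  forall f, nonneg_meas f -> Phi f = Psi f.
Proof.
move=> iPhi iPsi eqA f [mf f0].
have zero Xi : integral_like Xi -> Xi (fun=> 0) = 0.
  move=> iXi; transitivity (Xi (fun x => 0%:E * (fun=> 0) x)).
    by congr Xi; apply/funext => x; rewrite mul0e.
  rewrite (ilZ iXi) ?mul0e//; split => //; exact: measurable_cst.
have eqS (h : {nnsfun T >-> R}) :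
    Phi (fun x => (h x)%:E) = Psi (fun x => (h x)%:E).
  have -> : (fun x => (h x)%:E) = (fun x => \sum_(y <- fset_set (range h))
         (y%:E * (\1_(h @^-1` [set y]) x)%:E)).
    by apply/funext => x; rewrite fimfunE -fsumEFin// fsbig_finite.
  have : forall y, y \in (fset_set (range h) : seq R) -> (0 <= y)%R.
    by move=> y; rewrite in_fset_set// inE => -[x _ <-]; exact: fun_ge0.
  elim: (fset_set (range h) : seq R) => [|y s ih] s0.
    under eq_fun do rewrite big_nil.
    by rewrite (zero _ iPhi) (zero _ iPsi).
  under eq_fun do rewrite big_cons.
  have y0 : (0 <= y)%R by apply: s0; rewrite mem_head.
  have ms : forall z, z \in s -> (0 <= z)%R.
    by move=> z zs; apply: s0; rewrite in_cons zs orbT.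
  have mh z : measurable (h @^-1` [set z]) by [].
  have nnI z : nonneg_meas (fun x => (\1_(h @^-1` [set z]) x)%:E).
    exact: nonneg_meas_indic.
  have nnS : nonneg_meas (fun x => \sum_(z <- s)
      (z%:E * (\1_(h @^-1` [set z]) x)%:E)).
    split.
      by apply: emeasurable_sum => z; apply: measurable_funeM; exact: (nnI z).1.
    move=> x; rewrite big_seq sume_ge0// => z zs.
    by rewrite mule_ge0 ?lee_fin// ms.
  rewrite (ilD iPhi) ?(ilD iPsi)//; try exact: nonneg_measZ.
  by rewrite (ilZ iPhi) ?(ilZ iPsi)// eqA// ih.
pose u n x := (nnsfun_approx measurableT mf n x)%:E.
have nnu n : nonneg_meas (u n).
  by split; [exact/measurable_EFinP|move=> x; rewrite lee_fin].
have ndu x : nondecreasing_seq (u ^~ x).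
  by move=> a b ab; rewrite lee_fin; exact/lefP/nd_nnsfun_approx.
have -> : f = (fun x => limn (u ^~ x)).
  by apply/funext => x; apply/esym/cvg_lim => //; exact: cvg_nnsfun_approx.
apply: (@cvg_unique _ (@ereal_hausdorff R) _ _ _ _ (il_cvg iPhi nnu ndu)).
rewrite (_ : (fun n => Phi (u n)) = (fun n => Psi (u n))).
  exact: (il_cvg iPsi nnu ndu).
by apply/funext => n; exact: eqS.
Qed.

(** The closure properties that follow cover both sides of every identity below
    that is only given on measurable sets. *)
Lemma integral_like_eval (x : T) : integral_like (fun f => f x).
Proof.
split => //.
- by move=> f [_]; exact.
- by move=> u _ ndu; exact: ereal_nondecreasing_is_cvgn.
Qed.

Lemma integral_like_integral (m : {measure set T -> \bar R}) :
  integral_like (fun f => \int[m]_x f x).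
Proof.
split.
- by move=> f [_ f0]; apply: integral_ge0 => x _; exact: f0.
- by move=> f g [mf f0] [mg g0] fg; apply: ge0_le_integral.
- by move=> f g [mf f0] [mg g0]; rewrite ge0_integralD.
- by move=> c f c0 [mf f0]; rewrite ge0_integralZl.
- move=> u nnu ndu; apply: cvg_monotone_convergence => //.
  + by move=> n; exact: (nnu n).1.
  + by move=> n x _; exact: (nnu n).2.
Qed.

Lemma integral_likeD Phi Psi : integral_like Phi -> integral_like Psi ->
  integral_like (fun f => Phi f + Psi f).
Proof.
move=> iPhi iPsi; split.
- by move=> f nnf; rewrite adde_ge0 ?(il_ge0 iPhi) ?(il_ge0 iPsi).
- by move=> f g nnf nng fg; rewrite leeD ?(il_le iPhi) ?(il_le iPsi).
- by move=> f g nnf nng; rewrite (ilD iPhi)// (ilD iPsi)// addeACA.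
- move=> c f c0 nnf; rewrite (ilZ iPhi)// (ilZ iPsi)// ge0_muleDr//.
    exact: il_ge0.
  exact: il_ge0.
- move=> u nnu ndu; apply: cvgeD; last 2 first.
  + exact: il_cvg.
  + exact: il_cvg.
  by apply: ge0_adde_def; rewrite inE; apply: il_ge0 => //;
    exact: nonneg_meas_lim.
Qed.

Lemma integral_likeZ (c : R) Phi : (0 <= c)%R -> integral_like Phi ->
  integral_like (fun f => c%:E * Phi f).
Proof.
move=> c0 iPhi; split.
- by move=> f nnf; rewrite mule_ge0// (il_ge0 iPhi).
- by move=> f g nnf nng fg; rewrite lee_wpmul2l// (il_le iPhi).
- by move=> f g nnf nng; rewrite (ilD iPhi)// ge0_muleDr//; exact: il_ge0.
- by move=> e f e0 nnf; rewrite (ilZ iPhi)// muleCA.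
- by move=> u nnu ndu; apply: cvgeZl => //; exact: il_cvg.
Qed.

Lemma integral_like_sum (I : Type) (s : seq I)
    (Phi_ : I -> (T -> \bar R) -> \bar R) :
  (forall i, integral_like (Phi_ i)) ->
  integral_like (fun f => \sum_(i <- s) Phi_ i f).
Proof.
move=> iPhi; elim: s => [|i s ih].
  under eq_fun do rewrite big_nil; split => //.
  - by move=> f g _ _; rewrite adde0.
  - by move=> c f _ _; rewrite mule0.
  - by move=> u _ _; exact: cvg_cst.
by under eq_fun do rewrite big_cons; exact: integral_likeD.
Qed.

End integral_like.

Lemma integral_like_family (R : realType) (d d' : measure_display)
    (T : measurableType d) (S : measurableType d')
    (m : {measure set S -> \bar R}) (L : S -> (T -> \bar R) -> \bar R) :
  (forall w, integral_like (L w)) ->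
  (forall f, nonneg_meas f -> measurable_fun setT (L ^~ f)) ->
  integral_like (fun f => \int[m]_w L w f)%E.
Proof.
move=> iL mL.
have nnL f : nonneg_meas f -> nonneg_meas (L ^~ f).
  by move=> nnf; split; [exact: mL|move=> w; exact: (il_ge0 (iL w))].
have iI := integral_like_integral m.
split.
- by move=> f nnf; apply: (il_ge0 iI); exact: nnL.
- move=> f g nnf nng fg; apply: (il_le iI); try exact: nnL.
  by move=> w; exact: (il_le (iL w)).
- move=> f g nnf nng; rewrite -(ilD iI); try exact: nnL.
  by congr (integral _ _ _); apply/funext => w; exact: (ilD (iL w)).
- move=> c f c0 nnf; rewrite -(ilZ iI)//; try exact: nnL.
  by congr (integral _ _ _); apply/funext => w; exact: (ilZ (iL w)).
- move=> u nnu ndu.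
  have ndL w : nondecreasing_seq (fun n => L w (u n)).
    by move=> a b ab; apply: (il_le (iL w)) => // x; exact: ndu.
  rewrite [X in _ --> X](_ : _ = \int[m]_w limn (fun n => L w (u n)))%E.
    by apply: (il_cvg iI) => // n; exact: nnL.
  by congr (integral _ _ _); apply/funext => w; apply/esym/cvg_lim => //;
    exact: (il_cvg (iL w)).
Qed.

(** * Almost sure convergence and bounded functions *)

(** By monotone convergence the random series has finite expectation, hence
    converges almost surely. This serves as a Borel-Cantelli lemma in which
    second moments can be used directly. *)
Lemma ae_cvg0_summable (R : realType) (d : measure_display)
    (Omega : measurableType d) (m : {measure set Omega -> \bar R})
    (Y : nat -> Omega -> R) (B : R) :
  (forall j, measurable_fun setT (Y j)) -> (forall j w, 0 <= Y j w) ->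
  (forall N, (\sum_(0 <= j < N) \int[m]_w (Y j w)%:E <= B%:E)%E) ->
  {ae m, forall w, Y j w @[j --> \oo] --> (0 : R)}.
Proof.
move=> mY Y0 hB.
pose F w := (\sum_(j <oo) (Y j w)%:E)%E.
have F0 w : (0 <= F w)%E by apply: nneseries_ge0 => j _ _; rewrite lee_fin.
have mF : measurable_fun setT F.
  apply: ge0_emeasurable_sum => [j w _ _|j _]; first by rewrite lee_fin.
  exact/measurable_EFinP.
have iF : m.-integrable setT F.
  apply/integrableP; split=> //.
  under eq_integral do rewrite gee0_abs//.
  rewrite integral_nneseries//; last 2 first.
    by move=> j; exact/measurable_EFinP.
    by move=> j w _; rewrite lee_fin.
  apply: (@le_lt_trans _ _ B%:E); last exact: ltry.
  apply: lime_le; last exact: nearW.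
  by apply: is_cvg_nneseries => j _ _; apply: integral_ge0 => w _; rewrite lee_fin.
apply: filterS (integrable_ae measurableT iF) => w /(_ I) Ffin.
apply: (@cvg_series_cvg_0 R R^o).
apply: nondecreasing_is_cvgn.
  by apply: nondecreasing_series => j _ _; exact: Y0.
exists (fine (F w)) => _ [n _ <-].
rewrite -lee_fin fineK// -sumEFin.
by apply: nneseries_lim_ge => j _ _; rewrite lee_fin.
Qed.

Section bounded_functions.
Context (R : realType) (d : measure_display) (T : measurableType d).
Implicit Types f g : T -> R.

Definition bounded_meas f :=
  measurable_fun setT f /\ exists M, forall x, `|f x| <= M.

Lemma bm_cst c : bounded_meas (fun=> c).
Proof. by split; [exact: measurable_cst|exists `|c|]. Qed.

Lemma bmD f g : bounded_meas f -> bounded_meas g ->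
  bounded_meas (fun x => f x + g x).
Proof.
move=> [mf [a fa]] [mg [b gb]]; split; first exact: measurable_funD.
by exists (a + b) => x; rewrite (le_trans (ler_normD _ _))// lerD.
Qed.

Lemma bmN f : bounded_meas f -> bounded_meas (fun x => - f x).
Proof.
move=> [mf [a fa]]; split; first exact: measurableT_comp.
by exists a => x; rewrite normrN.
Qed.

Lemma bmB f g : bounded_meas f -> bounded_meas g ->
  bounded_meas (fun x => f x - g x).
Proof. by move=> bf bg; apply: bmD => //; exact: bmN. Qed.

Lemma bmM f g : bounded_meas f -> bounded_meas g ->
  bounded_meas (fun x => f x * g x).
Proof.
move=> [mf [a fa]] [mg [b gb]]; split; first exact: measurable_funM.
by exists (a * b) => x; rewrite normrM ler_pM.
Qed.

Variable P : {measure set T -> \bar R}.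
Hypothesis P1 : P setT = 1%E.

Lemma bm_integrable f : bounded_meas f -> P.-integrable setT (EFin \o f).
Proof.
move=> [mf [M fM]]; apply: measurable_bounded_integrable => //.
  by rewrite P1 ltry.
exists M; split; first exact: num_real.
by move=> x Mx y _; exact: le_trans (fM y) (ltW Mx).
Qed.

Lemma EFin_bm f : bounded_meas f ->
  (\int[P]_x (f x)%:E = (\int[P]_x f x)%:E)%E.
Proof.
by move=> bf; rewrite /Rintegral fineK//; exact: (integrable_fin_num measurableT
  (bm_integrable bf)).
Qed.

Lemma bm_intD f g : bounded_meas f -> bounded_meas g ->
  \int[P]_x (f x + g x) = \int[P]_x f x + \int[P]_x g x.
Proof. by move=> bf bg; rewrite RintegralD//; exact: bm_integrable. Qed.

Lemma bm_intB f g : bounded_meas f -> bounded_meas g ->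
  \int[P]_x (f x - g x) = \int[P]_x f x - \int[P]_x g x.
Proof. by move=> bf bg; rewrite RintegralB//; exact: bm_integrable. Qed.

Lemma bm_intZ c f : bounded_meas f ->
  \int[P]_x (c * f x) = c * \int[P]_x f x.
Proof. by move=> bf; rewrite RintegralZl//; exact: bm_integrable. Qed.

Lemma bm_int_cst c : \int[P]_x c = c.
Proof. by rewrite Rintegral_cst// P1 mulr1. Qed.

Lemma bm_le_int f g : bounded_meas f -> bounded_meas g ->
  (forall x, f x <= g x) -> \int[P]_x f x <= \int[P]_x g x.
Proof. by move=> bf bg fg; apply: le_Rintegral => //; exact: bm_integrable. Qed.

End bounded_functions.

(** * One tempered move *)

Section tempered_step.
Context (R : realType) (d : measure_display) (T : measurableType d).
Variables (u : R) (P : R.-pker T ~> T) (acc : T -> T -> R).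

(** The mean of [f] after one move; at the indicator of [A] this is
    [tempering_step]. Extended real values are needed for the unbounded
    weights. *)
Definition estep (n : nat) (y : nat -> T) (x : T) (f : T -> \bar R) : \bar R :=
  ((1 - u)%:E * \int[P x]_z f z +
   u%:E * ((n.+1%:R^-1)%:E *
     \sum_(0 <= l < n.+1)
       ((acc x (y l))%:E * f (y l) + (1 - acc x (y l))%:E * f x)))%E.

Definition empirical (n : nat) (y : nat -> T) (f : T -> R) : R :=
  n.+1%:R^-1 * \sum_(0 <= l < n.+1) f (y l).

(** The same mean for bounded [g], with the empirical measure of the upper level
    replaced by an arbitrary averaging functional [theta]. The difference
    [g y - g x] isolates the contribution of accepted swaps, which is the only
    place where [theta] enters. *)
Definition swap_op (theta : (T -> R) -> R) (g : T -> R) (x : T) : R :=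
  (1 - u) * \int[P x]_z g z +
  u * (g x + theta (fun y => acc x y * (g y - g x))).

Hypotheses (u01 : 0 < u < 1) (acc01 : forall x y, 0 <= acc x y <= 1).
Hypothesis macc : measurable_fun setT (fun z : T * T => acc z.1 z.2).

Lemma empirical_cst n y c : empirical n y (fun=> c) = c.
Proof.
by rewrite /empirical sumr_const_nat subn0 -[c *+ _]mulr_natr mulrCA mulVf ?mulr1.
Qed.

Lemma empiricalD n y f g :
  empirical n y (fun x => f x + g x) = empirical n y f + empirical n y g.
Proof. by rewrite /empirical big_split mulrDr. Qed.

Lemma empiricalZ n y c f :
  empirical n y (fun x => c * f x) = c * empirical n y f.
Proof. by rewrite /empirical -mulr_sumr mulrCA. Qed.

Lemma empiricalB n y f g :
  empirical n y (fun x => f x - g x) = empirical n y f - empirical n y g.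
Proof. by rewrite /empirical sumrB mulrBr. Qed.

Lemma le_empirical n y f g : (forall x, f x <= g x) ->
  empirical n y f <= empirical n y g.
Proof.
by move=> fg; rewrite /empirical ler_wpM2l// ?invr_ge0// ler_sum.
Qed.

Lemma estep_real n y x g : bounded_meas g ->
  estep n y x (EFin \o g) = (swap_op (empirical n y) g x)%:E.
Proof.
move=> bg; rewrite /estep (EFin_bm (prob_kernel x))// sumEFin -!EFinM -EFinD.
congr _%:E.
rewrite /swap_op; congr (_ + _ * _).
rewrite -[X in _ = X + _](empirical_cst n y) -empiricalD /empirical.
by congr (_ * _); apply: eq_bigr => l _; ring.
Qed.

Lemma integral_like_estep n y x : integral_like (estep n y x).
Proof.
have /andP[u0 u1] := u01.
apply: integral_likeD; apply: integral_likeZ; rewrite ?subr_ge0 ?ltW//.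
  exact: integral_like_integral.
apply: integral_likeZ; first by rewrite invr_ge0.
apply: integral_like_sum => l; apply: integral_likeD; apply: integral_likeZ;
  try exact: integral_like_eval.
- by case/andP: (acc01 x (y l)).
- by rewrite subr_ge0; case/andP: (acc01 x (y l)).
Qed.

Lemma measurable_estep (d' : measure_display) (S : measurableType d') n
    (Y : nat -> S -> T) (X : S -> T) f :
  (forall l, (l <= n)%N -> measurable_fun setT (Y l)) ->
  measurable_fun setT X -> nonneg_meas f ->
  measurable_fun setT (fun w => estep n (Y ^~ w) (X w) f).
Proof.
move=> mY mX [mf f0]; apply: emeasurable_funD; apply: measurable_funeM.
  have mPf : measurable_fun setT (fun x => \int[P x]_z f z)%E.
    by apply: measurable_fun_integral_kernel => // A; exact: measurable_kernel.
  exact: measurableT_comp mPf mX.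
apply: measurable_funeM.
under eq_fun do rewrite big_mkord; apply: emeasurable_sum => l.
have {}mY : measurable_fun setT (Y l) by apply: mY; rewrite -ltnS.
have mXY : measurable_fun setT (fun w => acc (X w) (Y l w)).
  have mp : measurable_fun setT (fun w => (X w, Y l w)).
    exact: measurable_fun_pair.
  exact: measurableT_comp macc mp.
apply: emeasurable_funD; apply: emeasurable_funM.
- exact/measurable_EFinP.
- exact: measurableT_comp.
- by apply/measurable_EFinP; exact: measurable_funB.
- exact: measurableT_comp.
Qed.

Lemma swap_op_shift n y c g x : bounded_meas g ->
  swap_op (empirical n y) (fun z => g z + c) x =
  swap_op (empirical n y) g x + c.
Proof.
move=> bg; rewrite /swap_op (bm_intD (prob_kernel x))//; last exact: bm_cst.
rewrite (bm_int_cst (prob_kernel x)).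
rewrite (_ : (fun z => _ * (_ + c - _)) = (fun z => acc x z * (g z - g x))).
  ring.
by apply/funext => z; ring.
Qed.

Lemma swap_op_bounds n y x (g : T -> R) (c : R) : measurable_fun setT g ->
  (forall z, 0 <= g z <= c) -> 0 <= swap_op (empirical n y) g x <= c.
Proof.
move=> mg gc.
have bg : bounded_meas g.
  split=> //; exists c => z; have /andP[g0 g1] := gc z.
  by rewrite ger0_norm.
have nn h : (forall z, 0 <= h z) -> bounded_meas h ->
    0 <= swap_op (empirical n y) h x.
  move=> h0 bh; rewrite -lee_fin -estep_real//.
  apply: (il_ge0 (integral_like_estep n y x)); split.
    by apply/measurable_EFinP; exact: bh.1.
  by move=> z; rewrite lee_fin.
apply/andP; split; first by apply: nn => // z; case/andP: (gc z).
have : 0 <= swap_op (empirical n y) (fun z => - g z + c) x.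
  apply: nn => [z|]; first by rewrite addrC subr_ge0; case/andP: (gc z).
  by apply: bmD; [exact: bmN|exact: bm_cst].
rewrite swap_op_shift; last exact: bmN.
suff -> : swap_op (empirical n y) (fun z => - g z) x =
  - swap_op (empirical n y) g x by lra.
have -> : (fun z => - g z) = (fun z => (-1) * g z).
  by apply/funext => z; rewrite mulN1r.
rewrite /swap_op (bm_intZ (prob_kernel x))//.
rewrite (_ : (fun z => _ * (-1 * _ - _)) =
    (fun z => (-1) * (acc x z * (g z - g x)))).
  by rewrite empiricalZ; ring.
by apply/funext => z; ring.
Qed.

End tempered_step.

(** * Limits along subsequences *)

Section subsequences.
Variable R : realType.

(** Consecutive squares differ by [2 * m + 1], which is negligible with respect
    to [m ^ 2], so bounded increments fill the gaps. Squares are sparse enough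
    for the variances [c / n] of the averages to be summable. *)
Lemma cvg_square_subseq (S : nat -> R) c :
  (forall n, `|S n.+1 - S n| <= c) ->
  (fun j => S (j.+1 ^ 2)%N / (j.+1 ^ 2)%N%:R) @ \oo --> (0 : R) ->
  (fun n => n%:R^-1 * S n) @ \oo --> (0 : R).
Proof.
move=> Sc S2; have c0 : 0 <= c by apply: le_trans (Sc 0%N).
have step a m : `|S (m + a)%N - S m| <= c * a%:R.
  elim: a => [|a ih]; first by rewrite addn0 subrr normr0 mulr0.
  rewrite addnS -[a.+1]addn1 natrD mulrDr mulr1 [leRHS]addrC.
  rewrite -(subrKA (S (m + a)%N)).
  by rewrite (le_trans (ler_normD _ _))// lerD.
apply/cvgrPdist_le => e e0.
have e20 : 0 < e / 2 by rewrite divr_gt0.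
move/cvgrPdist_le : S2 => /(_ _ e20)[m0 _ hm0].
(* From [m1] on, the [2 * k + 1 <= 3 * k] increments after [k ^ 2] add up to at
   most [e / 2 * k ^ 2]. *)
pose m1 := (Num.truncn (3 * c / (e / 2))).+1.
pose m := maxn m0 m1.
exists (m.+1 ^ 2)%N => //= n mn.
have n0 : (0 < n)%N by apply: leq_trans mn; rewrite expn_gt0.
have [k [k0 kn nk]] : exists k, [/\ (0 < k)%N, (k ^ 2 <= n)%N & (n < k.+1 ^ 2)%N].
  have P1 : (1 ^ 2 <= n)%N by [].
  have Pb i : (i ^ 2 <= n)%N -> (i <= n)%N.
    by move/(leq_trans _); apply; rewrite -mulnn; case: i => // i; rewrite leq_pmulr.
  have [k Pk kmax] := ex_maxnP (ex_intro (fun i => (i ^ 2 <= n)%N) 1%N P1) Pb.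
  exists k; split => //; first exact: kmax.
  by rewrite ltnNge; apply/negP => /kmax; rewrite ltnn.
have mk : (m < k)%N.
  by rewrite -ltnS -(@ltn_exp2r _ _ 2)//; exact: leq_ltn_trans nk.
case: k k0 kn nk mk => // k _ kn nk; rewrite ltnS => mk.
have nR : 0 < n%:R :> R by rewrite ltr0n.
rewrite sub0r normrN normrM gtr0_norm ?invr_gt0// mulrC ler_pdivrMr//.
have hk : `|S (k.+1 ^ 2)%N| <= e / 2 * n%:R.
  have k2 : 0 < (k.+1 ^ 2)%N%:R :> R by rewrite ltr0n expn_gt0.
  have := hm0 k (leq_trans (leq_maxl _ _) mk).
  rewrite sub0r normrN normrM normfV (gtr0_norm k2) ler_pdivrMr// => /le_trans.
  by apply; rewrite ler_pM2l// ler_nat.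
have hs : `|S n - S (k.+1 ^ 2)%N| <= e / 2 * n%:R.
  rewrite -{1}(subnKC kn); apply: (le_trans (step _ _)).
  have h3 : (n - k.+1 ^ 2 <= 3 * k.+1)%N by lia.
  have h4 : 3 * c <= e / 2 * k.+1%:R.
    rewrite [leRHS]mulrC -ler_pdivrMr//; apply/ltW.
    apply: (lt_le_trans (truncnS_gt _)); rewrite ler_nat.
    by apply: (leq_trans (leq_maxr m0 m1)); exact: (leq_trans mk).
  apply: (@le_trans _ _ (3 * c * k.+1%:R)).
    by rewrite [3 * c]mulrC -mulrA ler_wpM2l// -natrM ler_nat.
  apply: (@le_trans _ _ (e / 2 * k.+1%:R * k.+1%:R)).
    by rewrite ler_wpM2r.
  by rewrite -mulrA ler_pM2l// -natrM mulnn ler_nat.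
rewrite (_ : S n = (S n - S (k.+1 ^ 2)%N) + S (k.+1 ^ 2)%N); last by rewrite subrK.
apply: (le_trans (ler_normD _ _)).
by rewrite (splitr e) mulrDl lerD.
Qed.

(** For nonnegative terms every partial sum is at most the next dyadic one, and
    this loses only a factor [2]. *)
Lemma dyadic_average_bound (W : nat -> R) (K : R) (J : nat) :
  (forall i, 0 <= W i) ->
  (forall j, (J <= j)%N -> \sum_(0 <= i < (2 ^ j).+1) W i <= K * (2 ^ j)%N%:R) ->
  exists C, forall n, n.+1%:R^-1 * \sum_(0 <= i < n.+1) W i <= C.
Proof.
move=> W0 hK; pose A n := \sum_(0 <= i < n.+1) W i.
have homoA a b : (a <= b)%N -> A a <= A b.
  move=> ab; rewrite /A (@big_cat_nat _ _ _ a.+1 0 b.+1)//= lerDl.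
  exact: sumr_ge0.
have K0 : 0 <= K.
  have := hK J (leqnn J) => /(le_trans (sumr_ge0 _ _)) h.
  have : 0 <= K * (2 ^ J)%N%:R by apply: h.
  by rewrite pmulr_lge0// ltr0n expn_gt0.
exists (Num.max (2 * K) (A (2 ^ J)%N)) => n.
rewrite ler_pdivrMl ?ltr0n// mulrC.
pose j := up_log 2 n.+1.
have nj : (n.+1 <= 2 ^ j)%N by exact: up_logP.
have jn : (2 ^ j <= 2 * n.+1)%N.
  rewrite /j; case: n {nj j} => [|n]; first by [].
  have j0 : (0 < up_log 2 n.+2)%N by rewrite up_log_gt0.
  have := @up_log_bounds 2 n.+2 isT isT; case/andP=> + _.
  by case: (up_log 2 n.+2) j0 => //= j _ h; rewrite expnS leq_mul2l/= ltnW.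
have [Jj|jJ] := leqP J j.
  apply: (le_trans (homoA n (2 ^ j)%N (ltnW nj))).
  apply: (le_trans (hK _ Jj)).
  apply: (@le_trans _ _ (K * (2 * n.+1)%N%:R)).
    by rewrite ler_wpM2l// ler_nat.
  by rewrite natrM mulrA [K * _]mulrC ler_wpM2r// le_max lexx.
apply: (le_trans (homoA n (2 ^ J)%N _)).
  by rewrite ltnW// (leq_trans nj)// leq_exp2l// ltnW.
rewrite -[leLHS]mulr1 ler_pM//.
- exact: sumr_ge0.
- by rewrite le_max lexx orbT.
- by rewrite ler1n.
Qed.

Lemma cvg_sqr0 (v : nat -> R) : (fun j => v j ^+ 2) @ \oo --> (0 : R) ->
  v @ \oo --> (0 : R).
Proof.
move=> v2; apply/cvgrPdist_le => e e0.
have e2 : 0 < e ^+ 2 by rewrite exprn_gt0.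
move/cvgrPdist_le : v2 => /(_ _ e2); apply: filterS => j.
rewrite !sub0r !normrN normrX => h.
by rewrite -(@ler_pXn2r _ 2) ?nnegrE// ltW.
Qed.

Lemma sum_inv_square_le N : \sum_(0 <= j < N) ((j.+1 ^ 2)%N%:R)^-1 <= (2 : R).
Proof.
case: N => [|N]; first by rewrite big_geq.
suff h : \sum_(0 <= j < N.+1) ((j.+1 ^ 2)%N%:R)^-1 <= 2 - N.+1%:R^-1 :> R.
  by apply: (le_trans h); rewrite gerBl invr_ge0.
elim: N => [|N ih]; first by rewrite big_nat1 exp1n invr1; lra.
rewrite big_nat_recr//= (le_trans (lerD ih (lexx _)))//.
rewrite natrX.
have x0 : 0 < N.+1%:R :> R by rewrite ltr0n.
have e : N.+2%:R = N.+1%:R + 1 :> R by rewrite -natr1.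
rewrite e; set x := N.+1%:R in x0 *.
rewrite -subr_ge0 (_ : _ - _ = (x * (x + 1) ^+ 2)^-1).
  by rewrite invr_ge0 mulr_ge0 ?sqr_ge0// ltW.
by field; rewrite gt_eqF//= gt_eqF// ltr_wpDr.
Qed.

Lemma sum_geometric_le (q : R) N : 0 <= q < 1 ->
  \sum_(0 <= j < N) q ^+ j <= (1 - q)^-1.
Proof.
move=> /andP[q0 q1]; have q1' : 0 < 1 - q by rewrite subr_gt0.
rewrite -[leRHS]mul1r ler_pdivlMr//.
have -> : (\sum_(0 <= j < N) q ^+ j) * (1 - q) = 1 - q ^+ N.
  elim: N => [|N ih]; first by rewrite big_geq// mul0r expr0 subrr.
  by rewrite big_nat_recr//= mulrDl ih exprS; ring.
by rewrite gerBl exprn_ge0.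
Qed.

End subsequences.

(** * Martingale estimates for an adapted process *)

Section adapted_process.
Context (R : realType) (d : measure_display) (T : measurableType d).
Variables (u : R) (P : R.-pker T ~> T) (acc : T -> T -> R).
Hypotheses (u01 : 0 < u < 1) (acc01 : forall x y, 0 <= acc x y <= 1).
Hypothesis macc : measurable_fun setT (fun z : T * T => acc z.1 z.2).
Context (d' : measure_display) (Omega : measurableType d')
  (Pr : probability Omega R).
Variables (X Y : nat -> Omega -> T) (G : nat -> set (set Omega)).
Notation Fil n := (g_sigma_algebraType (G n)).
Hypothesis Gm : forall n B, <<s G n >> B -> measurable B.
Hypothesis Gmono : forall n B, <<s G n >> B -> <<s G n.+1 >> B.
Hypothesis mX : forall n l, (l <= n)%N ->
  measurable_fun setT (X l : Fil n -> T).
Hypothesis mY : forall n l, (l <= n)%N ->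
  measurable_fun setT (Y l : Fil n -> T).
Hypothesis step_law : forall n B A, <<s G n >> B -> measurable A ->
  Pr (B `&` X n.+1 @^-1` A) =
  (\int[Pr]_(w in B)
     estep u P acc n (Y ^~ w) (X n w) (fun x => (\1_A x)%:E))%E.

Implicit Types (g : T -> R) (c : R).

Let P1 : Pr setT = 1%E := probability_setT Pr.

Lemma coarse_measurable n (d2 : measure_display) (S : measurableType d2)
    (f : Omega -> S) :
  measurable_fun setT (f : Fil n -> S) -> measurable_fun setT f.
Proof.
by move=> mf _ A mA; apply: (Gm (n := n)); exact: (mf measurableT A mA).
Qed.

Lemma filtration_mono n (d2 : measure_display) (S : measurableType d2)
    (f : Omega -> S) :
  measurable_fun setT (f : Fil n -> S) ->
  measurable_fun setT (f : Fil n.+1 -> S).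
Proof. by move=> mf _ A mA; apply: Gmono; exact: (mf measurableT A mA). Qed.

Let mX' n : measurable_fun setT (X n).
Proof. exact: (coarse_measurable (mX (leqnn n))). Qed.

Definition one_step n (g : T -> R) (w : Omega) : R :=
  swap_op u P acc (empirical n (Y ^~ w)) g (X n w).

Lemma measurable_estep_process n f : nonneg_meas f ->
  measurable_fun setT
    (fun w : Fil n => estep u P acc n (Y ^~ w) (X n w) f).
Proof.
move=> nnf; apply: (@measurable_estep _ _ _ u P acc macc _ (Fil n) n Y (X n) f) => //.
  by move=> l ln; exact: mY.
exact: mX.
Qed.

(** The law of the next state is given on events [A]; both sides are
    integral-like in the integrand, so it extends to functions. *)
Lemma step_law_on B n f : <<s G n >> B -> nonneg_meas f ->
  (\int[Pr]_w ((\1_B w)%:E * f (X n.+1 w)) =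
   \int[Pr]_w ((\1_B w)%:E * estep u P acc n (Y ^~ w) (X n w) f))%E.
Proof.
move=> GB; have mB := Gm GB.
have mI : measurable_fun setT (fun w => (\1_B w)%:E : \bar R).
  by apply/measurable_EFinP; exact: measurable_indic.
move: f; apply: integral_like_eq.
- apply: (@integral_like_family _ _ _ _ _ Pr
    (fun w f => (\1_B w)%:E * f (X n.+1 w))%E) => [w|f [mf f0]].
    by apply: integral_likeZ => //; exact: integral_like_eval.
  by apply: emeasurable_funM => //; exact: measurableT_comp.
- apply: (@integral_like_family _ _ _ _ _ Pr
    (fun w f => (\1_B w)%:E * estep u P acc n (Y ^~ w) (X n w) f)%E)
    => [w|f nnf].
    by apply: integral_likeZ => //; exact: integral_like_estep.
  apply: emeasurable_funM => //; apply: (@coarse_measurable n).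
  exact: measurable_estep_process.
- move=> A mA.
  rewrite (_ : (fun w => _) = (fun w => (\1_(B `&` X n.+1 @^-1` A) w)%:E)).
    rewrite integral_indic//; last first.
      by apply: measurableI => //; rewrite -[_ @^-1` _]setTI; exact: mX'.
    rewrite setIT; apply: (etrans (step_law GB mA)); rewrite integral_mkcond.
    apply: eq_integral => w _; rewrite /patch indicE.
    by case: ifPn; rewrite ?mul1e// mul0e.
  by apply/funext => w; rewrite -EFinM !indicE in_setI -natrM mulnb.
Qed.

(** The same extension in the conditioning variable, from the events of the
    past to nonnegative functions [H] measurable with respect to the past. *)
Lemma step_law_weighted n (H : Omega -> \bar R) (g : T -> R) c :
  @nonneg_meas _ _ (Fil n) H -> measurable_fun setT g ->
  (forall z, 0 <= g z <= c) ->
  (\int[Pr]_w (H w * (g (X n.+1 w))%:E) =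
   \int[Pr]_w (H w * (one_step n g w)%:E))%E.
Proof.
move=> nnH mg gc.
have g0 z : 0 <= g z by case/andP: (gc z).
have bg : bounded_meas g.
  by split=> //; exists c => z; rewrite ger0_norm//; case/andP: (gc z).
have nng : nonneg_meas (EFin \o g).
  by split=> [|z]; [exact/measurable_EFinP|rewrite lee_fin].
have e w : estep u P acc n (Y ^~ w) (X n w) (EFin \o g) = (one_step n g w)%:E.
  by rewrite estep_real.
have s0 w : 0 <= one_step n g w.
  by case/andP: (swap_op_bounds P u01 acc01 n (Y ^~ w) (X n w) mg gc).
have ms : measurable_fun setT (fun w : Fil n => (one_step n g w)%:E).
  by under eq_fun do rewrite -e; exact: measurable_estep_process.
apply: (@integral_like_eq _ _ (Fil n)
  (fun f => \int[Pr]_w (f w * (g (X n.+1 w))%:E))%E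
  (fun f => \int[Pr]_w (f w * (one_step n g w)%:E))%E _ _ _ H) => //.
- apply: (@integral_like_family _ _ _ (Fil n) _ Pr
    (fun w f => f w * (g (X n.+1 w))%:E)%E) => [w|f [mf f0]].
    under eq_fun do rewrite muleC.
    by apply: integral_likeZ => //; exact: integral_like_eval.
  apply: emeasurable_funM; first exact: (@coarse_measurable n).
  by apply/measurable_EFinP; exact: measurableT_comp.
- apply: (@integral_like_family _ _ _ (Fil n) _ Pr
    (fun w f => f w * (one_step n g w)%:E)%E) => [w|f [mf f0]].
    under eq_fun do rewrite muleC.
    by apply: integral_likeZ => //; exact: integral_like_eval.
  by apply: emeasurable_funM; exact: (@coarse_measurable n).
- move=> B GB; rewrite (step_law_on GB nng).
  by apply: eq_integral => w _; rewrite e.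
Qed.

Lemma one_step_bounds n (g : T -> R) c w : measurable_fun setT g ->
  (forall z, 0 <= g z <= c) -> 0 <= one_step n g w <= c.
Proof. by move=> mg gc; exact: swap_op_bounds. Qed.

Lemma bm_one_step n g c : measurable_fun setT g ->
  (forall z, 0 <= g z <= c) ->
  @bounded_meas _ _ (Fil n) (one_step n g).
Proof.
move=> mg gc.
have bg : bounded_meas g.
  by split=> //; exists c => z; have /andP[? ?] := gc z; rewrite ger0_norm.
split; last first.
  by exists c => w; have /andP[? ?] := one_step_bounds n w mg gc;
    rewrite ger0_norm.
apply/measurable_EFinP.
rewrite (_ : EFin \o _ =
    (fun w : Fil n => estep u P acc n (Y ^~ w) (X n w) (EFin \o g))).
  apply: measurable_estep_process; split; first exact/measurable_EFinP.
  by move=> z; rewrite lee_fin; case/andP: (gc z).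
by apply/funext => w /=; rewrite estep_real.
Qed.

Lemma bm_coarse n (f : Omega -> R) :
  @bounded_meas _ _ (Fil n) f -> bounded_meas f.
Proof. by move=> [mf bf]; split=> //; exact: (@coarse_measurable n). Qed.

Lemma bm_mono n (f : Omega -> R) : @bounded_meas _ _ (Fil n) f ->
  @bounded_meas _ _ (Fil n.+1) f.
Proof. by move=> [mf bf]; split=> //; exact: filtration_mono. Qed.

Lemma bm_process n g : bounded_meas g -> @bounded_meas _ _ (Fil n) (g \o X n).
Proof.
move=> [mg [M gM]]; split; last by exists M => w /=.
by apply: measurableT_comp => //; exact: mX.
Qed.

(** This is the martingale property; adding a constant to [H] makes it
    nonnegative. *)
Lemma increment_orthogonal n (H : Omega -> R) (g : T -> R) c :
  @bounded_meas _ _ (Fil n) H ->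
  measurable_fun setT g -> (forall z, 0 <= g z <= c) ->
  \int[Pr]_w (H w * g (X n.+1 w)) = \int[Pr]_w (H w * one_step n g w).
Proof.
move=> bH mg gc; have [mH [M HM]] := bH.
have bg : bounded_meas g.
  by split=> //; exists c => z; have /andP[? ?] := gc z; rewrite ger0_norm.
have bgX := bm_coarse (bm_process n.+1 bg).
have bs := bm_coarse (bm_one_step n mg gc).
have M0 : 0 <= M by apply: le_trans (HM point).
have weighted (K : Omega -> R) : @bounded_meas _ _ (Fil n) K ->
    (forall w, 0 <= K w) ->
    \int[Pr]_w (K w * g (X n.+1 w)) = \int[Pr]_w (K w * one_step n g w).
  move=> bK K0; have bK' := bm_coarse bK.
  congr fine; have := @step_law_weighted n (EFin \o K) g c _ mg gc; apply.
  split=> [|w]; last by rewrite lee_fin.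
  by apply/measurable_EFinP; case: bK.
have e1 : \int[Pr]_w ((H w + M) * g (X n.+1 w)) =
    \int[Pr]_w ((H w + M) * one_step n g w).
  apply: weighted; first by apply: bmD => //; exact: bm_cst.
  by move=> w; have := HM w; rewrite ler_norml => /andP[? _]; lra.
have e2 : \int[Pr]_w (M * g (X n.+1 w)) = \int[Pr]_w (M * one_step n g w).
  by apply: weighted => //; exact: bm_cst.
have bH' := bm_coarse bH.
have bM := bm_cst Omega M.
have expand K : bounded_meas K -> \int[Pr]_w (H w * K w) =
    \int[Pr]_w ((H w + M) * K w) - \int[Pr]_w (M * K w).
  move=> bK; rewrite -(bm_intB P1); last 2 first.
  - by apply: bmM => //; exact: bmD.
  - exact: bmM.
  by congr Rintegral; apply/funext => w; ring.
by rewrite (expand _ bgX) (expand _ bs) e1 e2.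
Qed.

Definition mart_sum (g : T -> R) n w : R :=
  \sum_(0 <= i < n) (g (X i.+1 w) - one_step i g w).

Lemma bm_mart_sum g c n : measurable_fun setT g ->
  (forall z, 0 <= g z <= c) -> @bounded_meas _ _ (Fil n) (mart_sum g n).
Proof.
move=> mg gc.
have bg : bounded_meas g.
  by split=> //; exists c => z; have /andP[? ?] := gc z; rewrite ger0_norm.
rewrite /mart_sum; elim: n => [|n ih].
  by under eq_fun do rewrite big_geq//; exact: bm_cst.
under eq_fun do rewrite big_nat_recr//=.
apply: bmD; first exact: bm_mono.
by apply: bmB; [exact: bm_process|apply/bm_mono/bm_one_step].
Qed.

(** Orthogonality removes the cross terms, and the conditional variance of an
    increment is at most its conditional second moment. Keeping the moments of
    [g (X i.+1)] rather than the bound [c] is what the truncation in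
    [average_bounded] relies on. *)
Lemma mart_sum_second_moment g c n : measurable_fun setT g ->
  (forall z, 0 <= g z <= c) ->
  \int[Pr]_w (mart_sum g n w ^+ 2) <=
  \sum_(0 <= i < n) \int[Pr]_w (g (X i.+1 w) ^+ 2).
Proof.
move=> mg gc.
have bg : bounded_meas g.
  by split=> //; exists c => z; have /andP[? ?] := gc z; rewrite ger0_norm.
elim: n => [|n ih].
  under eq_fun do rewrite /mart_sum big_geq// expr0n/=.
  by rewrite (bm_int_cst P1) big_geq.
rewrite big_nat_recr//= (le_trans _ (lerD ih (lexx _)))//.
pose gX w := g (X n.+1 w); pose Q := one_step n g.
have bS := bm_mart_sum n mg gc.
have bQ := bm_one_step n mg gc.
have bS' := bm_coarse bS; have bQ' := bm_coarse bQ.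
have bgX : bounded_meas gX by exact: (bm_coarse (bm_process n.+1 bg)).
have orthS := increment_orthogonal bS mg gc.
have orthQ := increment_orthogonal bQ mg gc.
have SQ := bmM bS' bQ'; have Sg := bmM bS' bgX; have gg := bmM bgX bgX.
have QQ := bmM bQ' bQ'; have Qg := bmM bQ' bgX; have SS := bmM bS' bS'.
have -> : \int[Pr]_w (mart_sum g n.+1 w ^+ 2) =
    \int[Pr]_w (mart_sum g n w ^+ 2) + \int[Pr]_w (gX w ^+ 2)
    - \int[Pr]_w (Q w * Q w).
  transitivity (\int[Pr]_w (((mart_sum g n w * mart_sum g n w + gX w * gX w)
      - Q w * Q w)
      + 2 * ((mart_sum g n w * gX w - mart_sum g n w * Q w)
      - (Q w * gX w - Q w * Q w)))).
    congr Rintegral; apply/funext => w.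
    by rewrite /mart_sum big_nat_recr//= -/(mart_sum g n w) -/(gX w) -/(Q w); ring.
  have b1 := bmB (bmD SS gg) QQ.
  have b2 := bmB (bmB Sg SQ) (bmB Qg QQ).
  rewrite (bm_intD P1 b1); last by apply: bmM => //; exact: bm_cst.
  rewrite (bm_intZ P1 _ b2) (bm_intB P1 (bmB Sg SQ) (bmB Qg QQ)).
  rewrite (bm_intB P1 Sg SQ) (bm_intB P1 Qg QQ) orthS orthQ.
  rewrite (bm_intB P1 (bmD SS gg) QQ) (bm_intD P1 SS gg) !subrr mulr0 addr0.
  by under eq_Rintegral do rewrite -expr2.
rewrite gerBl; apply: Rintegral_ge0 => w _.
by rewrite -expr2 sqr_ge0.
Qed.

(** Along the squares the second moments of the averages are summable. *)
Lemma mart_sum_lln g : bounded_meas g ->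
  {ae Pr, forall w, n%:R^-1 * mart_sum g n w @[n --> \oo] --> (0 : R)}.
Proof.
move=> bg; have [mg [M gM]] := bg.
pose g' z := g z + M; pose c := 2 * M.
have mg' : measurable_fun setT g' by apply: measurable_funD.
have gc z : 0 <= g' z <= c.
  by have := gM z; rewrite ler_norml /g' /c => /andP[? ?]; apply/andP; split; lra.
have SS n w : mart_sum g' n w = mart_sum g n w.
  apply: eq_bigr => i _; rewrite /one_step /g' swap_op_shift//; ring.
have c0 : 0 <= c by have /andP[/le_trans h /h] := gc point.
have incr n w : `|mart_sum g' n.+1 w - mart_sum g' n w| <= c.
  rewrite /mart_sum big_nat_recr//= addrAC subrr add0r ler_norml.
  have /andP[a0 a1] := gc (X n.+1 w).
  have /andP[b0 b1] := one_step_bounds n w mg' gc.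
  by apply/andP; split; lra.
pose Q j w := (mart_sum g' (j.+1 ^ 2)%N w / (j.+1 ^ 2)%N%:R) ^+ 2.
have bQ j : bounded_meas (Q j).
  rewrite /Q; under eq_fun do rewrite expr2.
  have b : bounded_meas (fun w => mart_sum g' (j.+1 ^ 2)%N w / (j.+1 ^ 2)%N%:R).
    by apply: bmM; [exact: bm_coarse (bm_mart_sum _ mg' gc)|exact: bm_cst].
  exact: bmM.
have EQ j : \int[Pr]_w Q j w <= c ^+ 2 * ((j.+1 ^ 2)%N%:R)^-1.
  set N := (j.+1 ^ 2)%N; have N0 : 0 < N%:R :> R by rewrite ltr0n expn_gt0.
  have bS := bm_coarse (bm_mart_sum N mg' gc).
  have bS2 : bounded_meas (fun w => mart_sum g' N w ^+ 2).
    by under eq_fun do rewrite expr2; exact: bmM.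
  have -> : \int[Pr]_w Q j w = N%:R ^- 2 * \int[Pr]_w (mart_sum g' N w ^+ 2).
    rewrite -(bm_intZ P1)//; congr Rintegral; apply/funext => w.
    by rewrite /Q exprMn mulrC exprVn.
  rewrite ler_pdivrMl ?exprn_gt0//.
  have -> : N%:R ^+ 2 * (c ^+ 2 / N%:R) = \sum_(0 <= i < N) c ^+ 2.
    by rewrite sumr_const_nat subn0 -mulr_natl; field; rewrite gt_eqF.
  apply: (le_trans (mart_sum_second_moment N mg' gc)).
  apply: ler_sum => i _; rewrite -[leRHS](bm_int_cst P1).
  apply: (bm_le_int P1); [|exact: bm_cst|].
    under eq_fun do rewrite expr2.
    have b : bounded_meas (fun w => g' (X i.+1 w)).
      apply: bm_coarse (bm_process i.+1 _); split=> //.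
      by exists c => z; have /andP[? ?] := gc z; rewrite ger0_norm.
    exact: bmM.
  by move=> w; have /andP[? ?] := gc (X i.+1 w); rewrite ler_pXn2r ?nnegrE.
have : {ae Pr, forall w, Q j w @[j --> \oo] --> (0 : R)}.
  apply: (@ae_cvg0_summable _ _ _ Pr Q (c ^+ 2 * 2)).
  - by move=> j; exact: (bQ j).1.
  - by move=> j w; exact: sqr_ge0.
  - move=> N; under eq_bigr do rewrite (EFin_bm P1)//.
    rewrite sumEFin lee_fin; apply: (le_trans (ler_sum _ (fun j _ => EQ j))).
    by rewrite -mulr_sumr ler_wpM2l ?sqr_ge0// sum_inv_square_le.
apply: filterS => w /cvg_sqr0 hQ.
under eq_fun do rewrite -SS.
exact: (cvg_square_subseq (c := c)).
Qed.

(** Truncating [W = V `^ p^-1] at height [2 ^ j] over the block of the first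
    [2 ^ j] times makes the second moments summable over [j], because
    [p > 1]; the moment bound on [V] also makes the truncation eventually
    inactive. Along this block the drift inequality then controls the sum of
    [W], and dyadic times suffice because [W] is nonnegative. *)
Lemma average_bounded (V : T -> R) (p C lam : R) :
  measurable_fun setT V -> (forall z, 0 <= V z) -> 1 < p <= 2 ->
  (forall n, (\int[Pr]_w (V (X n w))%:E <= C%:E)%E) -> 0 <= lam < 1 ->
  {ae Pr, forall w, exists B, forall n c, 0 <= c ->
    one_step n (fun z => Num.min (V z `^ p^-1) c) w <=
      lam * V (X n w) `^ p^-1 + B} ->
  {ae Pr, forall w, exists B, forall n,
    empirical n (X ^~ w) (fun z => V z `^ p^-1) <= B}.
Proof.
move=> mV V0 /andP[p1 p2] EV /andP[lam0 lam1] drift.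
have p0 : 0 < p by apply: lt_trans p1.
pose W z := V z `^ p^-1.
have W0 z : 0 <= W z by exact: powR_ge0.
have WV z : W z `^ p = V z by rewrite /W -powRrM mulVf ?gt_eqF// powRr1.
have mW : measurable_fun setT W by exact: measurableT_comp (measurable_powR _) mV.
pose a j : R := (2 ^ j)%N%:R.
have a0 j : 0 < a j by rewrite ltr0n expn_gt0.
have a1 j : 1 <= a j by rewrite ler1n expn_gt0.
pose g j z := Num.min (W z) (a j).
have mg j : measurable_fun setT (g j) by apply: measurable_minr.
have gc j z : 0 <= g j z <= a j.
  by rewrite /g le_min W0 (ltW (a0 j)) ge_min lexx orbT.
have C0 : 0 <= C.
  rewrite -lee_fin; apply: le_trans (EV 0%N).
  by apply: integral_ge0 => w _; rewrite lee_fin.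
pose q : R := 2 `^ (1 - p).
have q01 : 0 <= q < 1.
  rewrite powR_ge0/= /q -opprB powRN invf_lt1 ?powR_gt0//.
  have h : 1 `^ (p - 1) < 2 `^ (p - 1) :> R.
    by apply: gt0_ltr_powR; rewrite ?nnegrE ?subr_gt0//; lra.
  by rewrite powR1 in h.
have qE j : a j `^ (1 - p) = q ^+ j.
  by rewrite /a natrX -powR_mulrn// -powRrM mulrC powRrM powR_mulrn// powR_ge0.
have bg j : bounded_meas (g j).
  by split=> //; exists (a j) => z; have /andP[? ?] := gc j z; rewrite ger0_norm.
have g2V j z : g j z ^+ 2 <= a j `^ (2 - p) * V z.
  have /andP[m0 ma] := gc j z.
  have -> : g j z ^+ 2 = g j z `^ (2 - p) * g j z `^ p.
    rewrite -powR_mulrn// -powRD ?subrK//.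
    by apply/implyP => /eqP h; exfalso; lra.
  rewrite ler_pM ?powR_ge0//.
    by apply: ge0_ler_powR; rewrite ?nnegrE ?subr_ge0// ltW.
  rewrite -WV; apply: ge0_ler_powR; rewrite ?nnegrE ?(ltW p0)//.
  by rewrite /g ge_min lexx.
have EV' n (c : R) : 0 <= c -> (\int[Pr]_w (c * V (X n w))%:E <= (c * C)%:E)%E.
  move=> c0; under eq_integral do rewrite EFinM.
  rewrite ge0_integralZl//.
  - by rewrite EFinM lee_wpmul2l// lee_fin.
  - by apply/measurable_EFinP; exact: measurableT_comp.
  - by move=> w _; rewrite lee_fin.
(* [Y1] controls the martingale part of the truncated process; [Y2] is at least
   [V (X i w) / a j `^ p] for each time of the block, so its convergence to 0
   says that eventually no value of [W] in the block exceeds the truncation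
   level. *)
pose Y1 j w := (mart_sum (g j) (2 ^ j)%N w / a j) ^+ 2.
pose Y2 j w := a j `^ (- p) * \sum_(0 <= i < (2 ^ j).+1) V (X i w).
have bS j n := bm_coarse (bm_mart_sum n (mg j) (gc j)).
have bY1 j : bounded_meas (Y1 j).
  rewrite /Y1; under eq_fun do rewrite expr2.
  have b : bounded_meas (fun w => mart_sum (g j) (2 ^ j)%N w / a j).
    by apply: bmM => //; exact: bm_cst.
  exact: bmM.
have mY2 j : measurable_fun setT (Y2 j).
  apply: measurable_funM => //; apply: measurable_sum => i.
  exact: measurableT_comp.
have EY1 j : \int[Pr]_w Y1 j w <= C * q ^+ j.
  have bS2 : bounded_meas (fun w => mart_sum (g j) (2 ^ j)%N w ^+ 2).
    by under eq_fun do rewrite expr2; exact: bmM.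
  have -> : \int[Pr]_w Y1 j w =
      a j ^- 2 * \int[Pr]_w (mart_sum (g j) (2 ^ j)%N w ^+ 2).
    rewrite -(bm_intZ P1)//; congr Rintegral; apply/funext => w.
    by rewrite /Y1 exprMn mulrC exprVn.
  rewrite ler_pdivrMl ?exprn_gt0//.
  apply: (le_trans (mart_sum_second_moment (2 ^ j)%N (mg j) (gc j))).
  have -> : a j ^+ 2 * (C * q ^+ j) =
      \sum_(0 <= i < 2 ^ j) (a j `^ (2 - p) * C).
    rewrite sumr_const_nat subn0 -[(_ * C) *+ _]mulr_natl -/(a j) -qE.
    rewrite (_ : 2 - p = 1 + (1 - p)); last by ring.
    rewrite [_ `^ (1 + (1 - p))]powRD ?powRr1 ?(ltW (a0 j))//; first by ring.
    by rewrite (gt_eqF (a0 j)) implybT.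
  apply: ler_sum => i _.
  have b2 : bounded_meas (fun w => g j (X i.+1 w) ^+ 2).
    under eq_fun do rewrite expr2.
    have b : bounded_meas (fun w => g j (X i.+1 w)).
      exact: bm_coarse (bm_process i.+1 (bg j)).
    exact: bmM.
  rewrite -lee_fin -(EFin_bm P1 b2).
  apply: (le_trans _ (EV' i.+1 _ (powR_ge0 _ _))).
  apply: ge0_le_integral => //.
  - by move=> w _; rewrite lee_fin sqr_ge0.
  - by apply/measurable_EFinP; exact: b2.1.
  - apply/measurable_EFinP; apply: measurable_funM => //.
    exact: measurableT_comp.
  - by move=> w _; rewrite lee_fin.
have EY2 j : (\int[Pr]_w (Y2 j w)%:E <= (2 * C * q ^+ j)%:E)%E.
  rewrite /Y2; under eq_integral do rewrite mulr_sumr -sumEFin.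
  rewrite ge0_integral_sum//; last 2 first.
  - move=> i; apply/measurable_EFinP; apply: measurable_funM => //.
    exact: measurableT_comp.
  - by move=> i w _; rewrite lee_fin mulr_ge0 ?powR_ge0.
  apply: (@le_trans _ _ (\sum_(0 <= i < (2 ^ j).+1) (a j `^ (- p) * C)%:E)%E).
    by apply: lee_sum => i _; exact/EV'/powR_ge0.
  rewrite sumEFin lee_fin sumr_const_nat subn0 -[(_ * C) *+ _]mulr_natl -qE.
  rewrite powRD ?powRr1 ?(ltW (a0 j))//; last by rewrite (gt_eqF (a0 j)) implybT.
  rewrite -natr1 -/(a j).
  have h : 0 <= a j `^ (- p) * C by rewrite mulr_ge0 ?powR_ge0.
  have := a1 j; nra.
have sumq (D : R) N : 0 <= D ->
    \sum_(0 <= j < N) D * q ^+ j <= D * (1 - q)^-1.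
  by move=> D0; rewrite -mulr_sumr ler_wpM2l// sum_geometric_le.
have cY1 : {ae Pr, forall w, Y1 j w @[j --> \oo] --> (0 : R)}.
  apply: (@ae_cvg0_summable _ _ _ Pr Y1 (C * (1 - q)^-1)).
  - by move=> j; exact: (bY1 j).1.
  - by move=> j w; exact: sqr_ge0.
  - move=> N; under eq_bigr do rewrite (EFin_bm P1)//.
    rewrite sumEFin lee_fin; apply: (le_trans (ler_sum _ (fun j _ => EY1 j))).
    exact: sumq.
have cY2 : {ae Pr, forall w, Y2 j w @[j --> \oo] --> (0 : R)}.
  apply: (@ae_cvg0_summable _ _ _ Pr Y2 (2 * C * (1 - q)^-1)) => //.
  - by move=> j w; rewrite mulr_ge0 ?powR_ge0// sumr_ge0.
  - move=> N; apply: (le_trans (lee_sum _ (fun j _ => EY2 j))).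
    by rewrite sumEFin lee_fin sumq// mulr_ge0.
near=> w.
have /cvg_sqr0 c1 : Y1 j w @[j --> \oo] --> (0 : R) by near: w.
have c2 : Y2 j w @[j --> \oo] --> (0 : R) by near: w.
have [B hB] : exists B, forall n c, 0 <= c ->
    one_step n (fun z => Num.min (V z `^ p^-1) c) w <=
      lam * V (X n w) `^ p^-1 + B by near: w.
move/cvgrPdist_le : c1 => /(_ 1 ltr01)[J1 _ hJ1].
move/cvgrPdist_le : c2 => /(_ 1 ltr01)[J2 _ hJ2].
have lam1' : 0 < 1 - lam by rewrite subr_gt0.
apply: (@dyadic_average_bound _ (fun i => W (X i w))
  ((1 + `|B| + lam * W (X 0%N w)) / (1 - lam) + W (X 0%N w)) (maxn J1 J2)) => //.
move=> j; rewrite geq_max => /andP[J1j J2j].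
have {hJ1}h1 : mart_sum (g j) (2 ^ j)%N w <= a j.
  have := hJ1 j J1j; rewrite sub0r normrN => /(le_trans (ler_norm _)).
  by rewrite ler_pdivrMr// mul1r.
have gW i : (i <= 2 ^ j)%N -> g j (X i w) = W (X i w).
  move=> ij; rewrite /g; apply/min_idPl.
  have Vi : V (X i w) <= a j `^ p.
    have := hJ2 j J2j; rewrite sub0r normrN => /(le_trans (ler_norm _)).
    rewrite /Y2 powRN mulrC ler_pdivrMr ?powR_gt0// mul1r; apply: le_trans.
    rewrite big_mkord (bigD1 (Ordinal (ij : (i < (2 ^ j).+1)%N)))//= lerDl.
    exact: sumr_ge0.
  have -> : a j = (a j `^ p) `^ p^-1.
    by rewrite -powRrM mulfV ?gt_eqF// powRr1// ltW.
  by apply: ge0_ler_powR; rewrite ?nnegrE ?invr_ge0 ?powR_ge0 ?(ltW p0).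
pose S := \sum_(0 <= i < 2 ^ j) W (X i.+1 w).
have S0 : \sum_(0 <= i < (2 ^ j).+1) W (X i w) = W (X 0%N w) + S.
  by rewrite big_nat_recl.
have SB : S <= a j + lam * (W (X 0%N w) + S) + a j * `|B|.
  have eS : S = mart_sum (g j) (2 ^ j)%N w +
      \sum_(0 <= i < 2 ^ j) one_step i (g j) w.
    rewrite /mart_sum sumrB subrK.
    by apply: eq_big_nat => i /andP[_ ij]; rewrite gW.
  rewrite [leLHS]eS -addrA lerD// -S0.
  apply: (@le_trans _ _ (\sum_(0 <= i < 2 ^ j) (lam * W (X i w) + `|B|))).
    apply: ler_sum => i _; apply: (le_trans (hB i _ (ltW (a0 j)))).
    by rewrite lerD2l ler_norm.
  rewrite big_split/= sumr_const_nat subn0 -[_ *+ _]mulr_natl -/(a j) lerD2r.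
  by rewrite -mulr_sumr ler_wpM2l// big_nat_recr//= lerDl.
rewrite S0 -/(a j) mulrDl [leRHS]addrC lerD//; first exact: ler_peMr.
rewrite mulrAC ler_pdivlMr//.
have wa : lam * W (X 0%N w) <= lam * W (X 0%N w) * a j.
  by rewrite ler_peMr// mulr_ge0.
nra.
Unshelve. all: by end_near. Qed.

(** The mean of [V (X n)] obeys the recursion
    [m n.+1 <= lam * m n + (b + CY)]. *)
Lemma moments_bounded (V : T -> R) (lam b CY : R) :
  measurable_fun setT V -> (forall z, 0 <= V z) -> 0 <= lam < 1 -> 0 <= b ->
  (forall n w, (estep u P acc n (Y ^~ w) (X n w) (EFin \o V) <=
     (lam * V (X n w) + b + empirical n (Y ^~ w) V)%:E)%E) ->
  (forall n, (\int[Pr]_w (V (Y n w))%:E <= CY%:E)%E) ->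
  (\int[Pr]_w (V (X 0%N w))%:E < +oo)%E ->
  exists C : R, forall n, (\int[Pr]_w (V (X n w))%:E <= C%:E)%E.
Proof.
move=> mV V0 /andP[lam0 lam1] b0 drift EY EX0.
have lam1' : 0 < 1 - lam by rewrite subr_gt0.
have nnV : nonneg_meas (EFin \o V).
  by split=> [|z]; [exact/measurable_EFinP|rewrite lee_fin].
have mVX n : measurable_fun setT (fun w => (V (X n w))%:E).
  by apply/measurable_EFinP; exact: measurableT_comp.
have mY' n : measurable_fun setT (Y n).
  by apply: (@coarse_measurable n); exact: mY.
have mVY n : measurable_fun setT (fun w => (V (Y n w))%:E).
  by apply/measurable_EFinP; exact: measurableT_comp.
pose m0 := fine (\int[Pr]_w (V (X 0%N w))%:E)%E.
have m0E : (\int[Pr]_w (V (X 0%N w))%:E = m0%:E)%E.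
  rewrite /m0 fineK// ge0_fin_numE//.
  by apply: integral_ge0 => w _; rewrite lee_fin.
exists (Num.max m0 ((b + CY) / (1 - lam))); elim=> [|n ih].
  by rewrite m0E lee_fin le_max lexx.
set C := Num.max _ _ in ih *.
have hC : lam * C + (b + CY) <= C.
  have : (b + CY) / (1 - lam) <= C by rewrite le_max lexx orbT.
  by rewrite ler_pdivrMr//; lra.
have GT : <<s G n >> setT by exact: (@measurableT _ (Fil n)).
have -> : (\int[Pr]_w (V (X n.+1 w))%:E =
    \int[Pr]_w estep u P acc n (Y ^~ w) (X n w) (EFin \o V))%E.
  transitivity (\int[Pr]_w ((\1_setT w)%:E * (EFin \o V) (X n.+1 w)))%E.
    by apply: eq_integral => w _; rewrite indicT mul1e.
  rewrite step_law_on//; apply: eq_integral => w _.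
  by rewrite indicT mul1e.
apply: (@le_trans _ _ (\int[Pr]_w (((lam%:E * (V (X n w))%:E + b%:E) +
   n.+1%:R^-1%:E * \sum_(0 <= l < n.+1) (V (Y l w))%:E)))%E).
  apply: ge0_le_integral => //.
  - by move=> w _; apply: (il_ge0 (integral_like_estep _ u01 acc01 _ _ _)).
  - by apply: (@coarse_measurable n); exact: measurable_estep_process.
  - apply: emeasurable_funD; last first.
      by apply: measurable_funeM; exact: emeasurable_sum.
    by apply: emeasurable_funD; [exact: measurable_funeM|exact: measurable_cst].
  - move=> w _; apply: (le_trans (drift n w)).
    by rewrite sumEFin -!EFinM -!EFinD.
have nS w : (0 <= n.+1%:R^-1%:E * \sum_(0 <= l < n.+1) (V (Y l w))%:E)%E.
  by rewrite mule_ge0 ?lee_fin ?invr_ge0// sume_ge0// => l _; rewrite lee_fin.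
rewrite ge0_integralD//; last 3 first.
- by move=> w _; rewrite adde_ge0 ?lee_fin// mulr_ge0.
- by apply: emeasurable_funD; [exact: measurable_funeM|exact: measurable_cst].
- by apply: measurable_funeM; exact: emeasurable_sum.
rewrite ge0_integralD//; last 2 first.
- by move=> w _; rewrite lee_fin mulr_ge0.
- exact: measurable_funeM.
rewrite ge0_integralZl//; last by move=> w _; rewrite lee_fin.
rewrite integral_cst// ge0_integralZl//; last 2 first.
- exact: emeasurable_sum.
- by move=> w _; rewrite sume_ge0// => l _; rewrite lee_fin.
rewrite ge0_integral_sum//; last by move=> l w _; rewrite lee_fin.
apply: (@le_trans _ _ (lam%:E * C%:E + b%:E * 1 + CY%:E)%E); last first.
  by rewrite mule1 -EFinM -!EFinD lee_fin -addrA.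
apply: leeD; first apply: leeD.
- by rewrite lee_wpmul2l// lee_fin.
- by rewrite (_ : _ setT = 1%E).
apply: (@le_trans _ _ (n.+1%:R^-1%:E * \sum_(0 <= l < n.+1) CY%:E)%E).
  by rewrite lee_wpmul2l ?lee_fin ?invr_ge0// lee_sum.
rewrite sumEFin -EFinM lee_fin sumr_const_nat subn0 -[CY *+ _]mulr_natl mulrA.
by rewrite mulVf ?mul1r.
Qed.

End adapted_process.

(** * Averaging functionals *)

Section averaging.
Context (R : realType) (d : measure_display) (T : measurableType d).
Variables (V : T -> R) (v0 : R).
Hypotheses (mV : measurable_fun setT V) (v0_gt0 : 0 < v0)
  (v0V : forall x, v0 <= V x).
Implicit Types (f g : T -> R) (theta : (T -> R) -> R).

Definition dominated f := measurable_fun setT f /\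
  exists C, forall x, `|f x| <= C * V x.

Let V0 x : 0 <= V x. Proof. exact: le_trans (ltW v0_gt0) (v0V x). Qed.

Lemma domD f g : dominated f -> dominated g -> dominated (fun x => f x + g x).
Proof.
move=> [mf [a fa]] [mg [b gb]]; split; first exact: measurable_funD.
by exists (a + b) => x; rewrite mulrDl (le_trans (ler_normD _ _))// lerD.
Qed.

Lemma dom_bm f : bounded_meas f -> dominated f.
Proof.
move=> [mf [a fa]]; split => //; exists (a / v0) => x.
have a0 : 0 <= a by apply: le_trans (fa x).
rewrite (le_trans (fa x))// mulrAC ler_pdivlMr// ler_wpM2l//.
Qed.

Lemma domM f g : bounded_meas f -> dominated g -> dominated (fun x => f x * g x).
Proof.
move=> [mf [a fa]] [mg [b gb]]; split; first exact: measurable_funM.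
by exists (a * b) => x; rewrite normrM -mulrA ler_pM.
Qed.

Lemma domZ c f : dominated f -> dominated (fun x => c * f x).
Proof. by move=> df; apply: domM => //; exact: bm_cst. Qed.

Lemma domB f g : dominated f -> dominated g -> dominated (fun x => f x - g x).
Proof.
move=> df dg; under eq_fun do rewrite -[- g _]mulN1r.
by apply: domD => //; exact: domZ.
Qed.

(** The expectation functional of a probability measure that integrates [V],
    seen through the properties that empirical means and integrals against a
    density share. *)
Record averaging theta : Prop := Averaging {
  avD : forall f g, dominated f -> dominated g ->
    theta (fun x => f x + g x) = theta f + theta g ;
  avZ : forall c f, dominated f -> theta (fun x => c * f x) = c * theta f ;
  av_le : forall f g, dominated f -> dominated g -> (forall x, f x <= g x) ->
    theta f <= theta g ;
  av_cst : forall c, theta (fun=> c) = c }.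

Lemma avB theta f g : averaging theta -> dominated f -> dominated g ->
  theta (fun x => f x - g x) = theta f - theta g.
Proof.
move=> av df dg; rewrite -[- theta g]mulN1r -(avZ av)// -(avD av)//.
  by congr theta; apply/funext => x; rewrite mulN1r.
exact: domZ.
Qed.

Lemma av_norm_le theta f h : averaging theta -> dominated f -> dominated h ->
  (forall x, `|f x| <= h x) -> `|theta f| <= theta h.
Proof.
move=> av df dh fh; rewrite ler_norml; apply/andP; split.
  rewrite -mulN1r -(avZ av)//; apply: (av_le av) => //; first exact: domZ.
  by move=> x; have := fh x; rewrite ler_norml mulN1r => /andP[].
by apply: (av_le av) => // x; exact: le_trans (ler_norm _) (fh x).
Qed.

Lemma averaging_empirical n y : averaging (@empirical R d T n y).
Proof.
split.
- by move=> f g _ _; exact: empiricalD.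
- by move=> c f _; exact: empiricalZ.
- by move=> f g _ _; exact: le_empirical.
- by move=> c; exact: empirical_cst.
Qed.

Lemma dominated_integrable (mu : {measure set T -> \bar R}) (rho f : T -> R) :
  measurable_fun setT rho -> (forall x, 0 <= rho x) ->
  (\int[mu]_x (V x * rho x)%:E < +oo)%E -> dominated f ->
  mu.-integrable setT (EFin \o (fun x => f x * rho x)).
Proof.
move=> mrho rho0 Vfin [mf [C fC]].
have iV : mu.-integrable setT (EFin \o (fun x => V x * rho x)).
  apply/integrableP; split.
    by apply/measurable_EFinP; exact: measurable_funM.
  under eq_integral => x _ do rewrite gee0_abs ?lee_fin ?mulr_ge0//.
  exact: Vfin.
apply: (le_integrable measurableT _ _ (integrableZl measurableT C iV)).
  by apply/measurable_EFinP; exact: measurable_funM.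
move=> x _ /=; rewrite lee_fin !normrM (ger0_norm (rho0 x)) (ger0_norm (V0 x)).
rewrite mulrA ler_wpM2r// (le_trans (fC x))// ler_wpM2r//; exact: ler_norm.
Qed.

Lemma averaging_density (mu : {measure set T -> \bar R}) (rho : T -> R) :
  measurable_fun setT rho -> (forall x, 0 <= rho x) ->
  (\int[mu]_x (V x * rho x)%:E < +oo)%E -> \int[mu]_x rho x = 1 ->
  averaging (fun f => \int[mu]_x (f x * rho x)).
Proof.
move=> mrho rho0 Vfin rho1.
have int f := @dominated_integrable mu rho f mrho rho0 Vfin.
split.
- move=> f g df dg; rewrite -RintegralD//; try exact: int.
  by congr Rintegral; apply/funext => x; rewrite mulrDl.
- move=> c f df; rewrite -RintegralZl//; last exact: int.
  by congr Rintegral; apply/funext => x; rewrite mulrA.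
- move=> f g df dg fg; apply: le_Rintegral => //; try exact: int.
  by move=> x _; rewrite ler_wpM2r.
- move=> c; rewrite RintegralZl ?rho1 ?mulr1//.
  rewrite (_ : EFin \o rho = EFin \o (fun x => 1 * rho x)).
    by apply: int; apply: dom_bm; exact: bm_cst.
  by apply/funext => x /=; rewrite mul1r.
Qed.

End averaging.

(** * Contraction of the swap operator *)

Section swap_operator.
Context (R : realType) (d : measure_display) (T : measurableType d).
Variables (V : T -> R) (v0 : R).
Hypotheses (v0_gt0 : 0 < v0) (v0V : forall x, v0 <= V x).
Variables (u : R) (P : R.-pker T ~> T) (acc : T -> T -> R).
Hypotheses (u01 : 0 < u < 1) (acc01 : forall x y, 0 <= acc x y <= 1).
Hypothesis macc : measurable_fun setT (fun z : T * T => acc z.1 z.2).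
Variable theta : (T -> R) -> R.
Hypothesis av : averaging V theta.
Implicit Types f g h : T -> R.

Let bd g : bounded_meas g -> dominated V g.
Proof. exact: (dom_bm v0_gt0 v0V). Qed.

Lemma bm_acc x : bounded_meas (acc x).
Proof.
split; last by exists 1 => y; have /andP[? ?] := acc01 x y; rewrite ger0_norm.
have mp : measurable_fun setT (fun y : T => (x, y)).
  exact: measurable_fun_pair.
exact: measurableT_comp macc mp.
Qed.

Lemma bm_swap g x : bounded_meas g ->
  bounded_meas (fun y => acc x y * (g y - g x)).
Proof.
by move=> bg; apply: bmM; [exact: bm_acc|apply: bmB => //; exact: bm_cst].
Qed.

Lemma swap_opD f g x : bounded_meas f -> bounded_meas g ->
  swap_op u P acc theta (fun z => f z + g z) x =
  swap_op u P acc theta f x + swap_op u P acc theta g x.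
Proof.
move=> bf bg; rewrite /swap_op (bm_intD (prob_kernel x))//.
rewrite (_ : (fun y => _ * (_ + _ - _)) =
    (fun y => acc x y * (f y - f x) + acc x y * (g y - g x))).
  by rewrite (avD av); [ring|exact: bd (bm_swap _ _)..].
by apply/funext => y; ring.
Qed.

Lemma swap_opZ c g x : bounded_meas g ->
  swap_op u P acc theta (fun z => c * g z) x = c * swap_op u P acc theta g x.
Proof.
move=> bg; rewrite /swap_op (bm_intZ (prob_kernel x))//.
rewrite (_ : (fun y => _ * (_ - _)) =
    (fun y => c * (acc x y * (g y - g x)))).
  by rewrite (avZ av); [ring|exact: bd (bm_swap _ _)].
by apply/funext => y; ring.
Qed.

Lemma swap_op_cst c x : swap_op u P acc theta (fun=> c) x = c.
Proof.
rewrite /swap_op (bm_int_cst (prob_kernel x)) (_ : (fun y => _) = fun=> 0).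
  by rewrite (av_cst av); ring.
by apply/funext => y; rewrite subrr mulr0.
Qed.

Lemma swap_op_split g x : bounded_meas g -> swap_op u P acc theta g x =
  (1 - u) * \int[P x]_z g z +
  u * (theta (fun y => acc x y * g y) + (g x - g x * theta (acc x))).
Proof.
move=> bg; rewrite /swap_op; congr (_ + _ * _).
rewrite addrCA; congr (_ + _).
rewrite -(avZ av) -?(avB av)//; try apply: bd.
- by congr theta; apply/funext => y; ring.
- by apply: bmM => //; exact: bm_acc.
- by apply: bmM; [exact: bm_cst|exact: bm_acc].
- exact: bm_acc.
Qed.

Lemma swap_op_lower g h x m : bounded_meas g -> bounded_meas h ->
  (forall z, m <= g z) -> (forall y, 0 <= h y <= acc x y) ->
  m + u * theta (fun y => h y * (g y - m)) <= swap_op u P acc theta g x.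
Proof.
move=> bg bh mg hacc; have /andP[u0 u1] := u01.
have bm' := bm_cst T m.
have intP : m <= \int[P x]_z g z.
  rewrite -[leLHS](bm_int_cst (prob_kernel (s := P) x) m).
  by apply: (bm_le_int (prob_kernel x)).
have bgm : bounded_meas (fun y => g y - m) by exact: bmB.
have h1 : theta (fun y => h y * (g y - m)) <=
    theta (fun y => acc x y * (g y - m)).
  apply: (av_le av); try by apply: bd; apply: bmM => //; exact: bm_acc.
  by move=> y; have /andP[_ ?] := hacc y; rewrite ler_wpM2r// subr_ge0.
have h2 : theta (acc x) <= 1.
  rewrite -(av_cst av 1); apply: (av_le av); try apply: bd.
  - exact: bm_acc.
  - exact: bm_cst.
  - by move=> y; case/andP: (acc01 x y).
have e : theta (fun y => acc x y * (g y - g x)) =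
    theta (fun y => acc x y * (g y - m)) - (g x - m) * theta (acc x).
  rewrite -(avZ av) -?(avB av)//; try apply: bd.
  - by congr theta; apply/funext => y; ring.
  - by apply: bmM => //; exact: bm_acc.
  - by apply: bmM; [exact: bm_cst|exact: bm_acc].
  - exact: bm_acc.
rewrite /swap_op e; have := mg x.
set A := theta (fun y => h y * _) in h1 *.
set B := theta (fun y => acc x y * _) in h1 *.
move=> gx.
have h3 : 0 <= (g x - m) * (1 - theta (acc x)).
  by rewrite mulr_ge0// subr_ge0.
nra.
Qed.

(** The part [h] of the acceptance probability that does not depend on the
    current state acts as a regeneration with weight [u * theta h], so the
    oscillation of a function shrinks by the remaining factor. *)
Lemma swap_op_contract g h m M : bounded_meas g -> bounded_meas h ->
  (forall z, m <= g z <= M) -> (forall x y, 0 <= h y <= acc x y) ->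
  exists m' M', (forall x, m' <= swap_op u P acc theta g x <= M') /\
    M' - m' = (1 - u * theta h) * (M - m).
Proof.
move=> bg bh gmM hacc.
have bm' := bm_cst T m; have bM' := bm_cst T M.
exists (m + u * theta (fun y => h y * (g y - m))).
exists (M - u * theta (fun y => h y * (M - g y))); split.
  move=> x; apply/andP; split.
    by apply: swap_op_lower => // z; case/andP: (gmM z).
  have := @swap_op_lower (fun z => -1 * g z) h x (- M).
  rewrite swap_opZ//.
  have -> : (fun y => h y * (-1 * g y - - M)) = (fun y => h y * (M - g y)).
    by apply/funext => y; ring.
  move=> H; rewrite -subr_ge0.
  have {H} : - M + u * theta (fun y => h y * (M - g y)) <=
      -1 * swap_op u P acc theta g x.
    apply: H => //; first by apply: bmM => //; exact: bm_cst.
    by move=> z; case/andP: (gmM z) => _ gM; rewrite mulN1r lerN2.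
  lra.
have e : theta (fun y => h y * (M - g y)) + theta (fun y => h y * (g y - m)) =
    (M - m) * theta h.
  rewrite -(avZ av) -?(avD av); try apply: bd => //.
  - by congr theta; apply/funext => y; ring.
  - by apply: bmM => //; exact: bmB.
  - by apply: bmM => //; exact: bmB.
set B := theta _ in e *; set A := theta _ in e *.
transitivity (M - m - u * (B + A)); first by ring.
by rewrite e; ring.
Qed.

End swap_operator.

(** * Invariance *)

Section as_sigma_finite.
Context (R : realType) (d : measure_display) (T : measurableType d).
Variables (mu : {measure set T -> \bar R}) (sf : sigma_finite setT mu).

(** A copy of [mu] that carries the proof of sigma-finiteness, as the product
    measure theorems ask for it as a structure. *)
Definition as_sigma_finite & sigma_finite setT mu : set T -> \bar R := mu.

HB.instance Definition _ := Measure.copy (as_sigma_finite sf) mu.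
HB.instance Definition _ :=
  @Measure_isSigmaFinite.Build _ _ _ (as_sigma_finite sf) sf.

End as_sigma_finite.

Section invariance.
Context (R : realType) (d : measure_display) (T : measurableType d).
Variable mu : {measure set T -> \bar R}.

(** The sets where [g] exceeds [n.+1%:R^-1] cover the space because [g] is
    positive, and have finite measure by the Markov inequality. *)
Lemma sigma_finite_of_density (g : T -> R) : measurable_fun setT g ->
  (forall x, 0 < g x) -> (\int[mu]_x (g x)%:E < +oo)%E ->
  sigma_finite setT mu.
Proof.
move=> mg g0 gfin.
pose A n := [set x | n.+1%:R^-1 < g x].
have mA n : measurable (A n).
  rewrite (_ : A n = g @^-1` `]n.+1%:R^-1, +oo[%classic).
    by rewrite -[_ @^-1` _]setTI; exact: mg.
  by apply/seteqP; split => x /=; rewrite in_itv/= andbT.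
exists A.
  apply/seteqP; split => // x _.
  have gx := g0 x.
  exists (Num.truncn (g x)^-1) => //; rewrite /A /=.
  by rewrite invf_plt ?posrE// truncnS_gt.
move=> n; split; first exact: mA.
have h : (mu (A n) <= n.+1%:R%:E * \int[mu]_x (g x)%:E)%E.
  rewrite -ge0_integralZl//.
  - have -> : mu (A n) = (\int[mu]_x (\1_(A n) x)%:E)%E.
      by rewrite integral_indic// setIT.
    apply: ge0_le_integral => //.
    + by apply/measurable_EFinP; exact: measurable_indic.
    + by apply: measurable_funeM; exact/measurable_EFinP.
    + move=> x _; rewrite -EFinM lee_fin indicE.
      case: (boolP (x \in A n)) => [|_]; last by rewrite mulr_ge0// ltW.
      rewrite inE /A /= => h.
      by rewrite -ler_pdivrMl ?ltr0n// mulr1 ltW.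
  - exact/measurable_EFinP.
  - by move=> x _; rewrite lee_fin ltW.
by apply: (le_lt_trans h); rewrite lte_mul_pinfty// lee_fin.
Qed.

(** Detailed balance: after Tonelli, exchanging the names of the two states
    turns one side into the other. *)
Lemma swap_detailed_balance (smu : {sigma_finite_measure set T -> \bar R})
    (p q g : T -> R) (acc : T -> T -> R) :
  measurable_fun setT p -> measurable_fun setT q -> measurable_fun setT g ->
  measurable_fun setT (fun z : T * T => acc z.1 z.2) ->
  (forall x, 0 <= p x) -> (forall x, 0 <= q x) -> (forall x, 0 <= g x) ->
  (forall x y, 0 <= acc x y) ->
  (forall x y, p x * q y * acc x y = p y * q x * acc y x) ->
  (\int[smu]_x \int[smu]_y (p x * q y * acc x y * g y)%:E =
   \int[smu]_x \int[smu]_y (p x * q y * acc x y * g x)%:E)%E.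
Proof.
move=> mp mq mg macc p0 q0 g0 a0 sym.
pose F (z : T * T) := (p z.1 * q z.2 * acc z.1 z.2 * g z.2)%:E.
have mF : measurable_fun setT F.
  apply/measurable_EFinP; repeat apply: measurable_funM => //;
  exact: measurableT_comp.
have F0 z : (0 <= F z)%E by rewrite lee_fin !mulr_ge0.
transitivity (\int[smu]_x \int[smu]_y F (x, y))%E; first by [].
rewrite (@fubini_tonelli _ _ _ _ _ smu smu F)//.
by apply: eq_integral => x _; apply: eq_integral => y _; rewrite /F /= sym.
Qed.

End invariance.

Section invariant_swap_operator.
Context (R : realType) (d : measure_display) (T : measurableType d).
Variable mu : {measure set T -> \bar R}.
Hypothesis sf : sigma_finite setT mu.
Variables (V : T -> R) (v0 : R).
Hypotheses (v0_gt0 : 0 < v0) (v0V : forall x, v0 <= V x).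
Variables (u : R) (P : R.-pker T ~> T) (acc : T -> T -> R).
Hypotheses (u01 : 0 < u < 1) (acc01 : forall x y, 0 <= acc x y <= 1).
Hypothesis macc : measurable_fun setT (fun z : T * T => acc z.1 z.2).
Variables p q : T -> R.
Hypotheses (mp : measurable_fun setT p) (mq : measurable_fun setT q).
Hypotheses (p0 : forall x, 0 <= p x) (q0 : forall x, 0 <= q x).
Hypothesis sym : forall x y, p x * q y * acc x y = p y * q x * acc y x.
Hypothesis invP : invariant_density mu p P.
Let Lp (f : T -> R) := \int[mu]_x (f x * p x).
Let Lq (f : T -> R) := \int[mu]_x (f x * q x).
Hypotheses (avp : averaging V Lp) (avq : averaging V Lq).
Hypothesis intq : mu.-integrable setT (EFin \o q).

Let bd g : bounded_meas g -> dominated V g.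
Proof. exact: (dom_bm v0_gt0 v0V). Qed.

Let int_bm (rho g : T -> R) : mu.-integrable setT (EFin \o rho) ->
  (forall x, 0 <= rho x) ->
  bounded_meas g -> mu.-integrable setT (EFin \o (fun x => g x * rho x)).
Proof.
move=> irho rho0 [mg [C gC]].
apply: (le_integrable measurableT _ _ (integrableZl measurableT C irho)).
  apply/measurable_EFinP; apply: measurable_funM => //.
  by apply/measurable_EFinP; exact: (measurable_int mu).
move=> x _ /=; rewrite lee_fin !normrM (ger0_norm (rho0 x)).
by rewrite ler_wpM2r// (le_trans (gC x))// ler_norm.
Qed.

(** Invariance is assumed on events, and both sides are integral-like. *)
Lemma kernel_integral_invariant (f : T -> \bar R) : nonneg_meas f ->
  (\int[mu]_x ((p x)%:E * \int[P x]_y f y) = \int[mu]_x ((p x)%:E * f x))%E.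
Proof.
have mpE : measurable_fun setT (fun x => (p x)%:E : \bar R).
  exact/measurable_EFinP.
move: f; apply: (@integral_like_eq _ _ T
   (fun f => \int[mu]_x ((p x)%:E * \int[P x]_y f y))%E
   (fun f => \int[mu]_x ((p x)%:E * f x))%E).
- apply: (@integral_like_family _ _ _ _ _ mu
    (fun x f => (p x)%:E * \int[P x]_y f y)%E) => [x|f [mf f0]].
    by apply: integral_likeZ => //; exact: integral_like_integral.
  apply: emeasurable_funM => //.
  by apply: measurable_fun_integral_kernel => // A; exact: measurable_kernel.
- apply: (@integral_like_family _ _ _ _ _ mu
    (fun x f => (p x)%:E * f x)%E) => [x|f [mf f0]].
    by apply: integral_likeZ => //; exact: integral_like_eval.
  exact: emeasurable_funM.
- move=> A mA; transitivity (\int[mu]_x ((p x)%:E * P x A))%E.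
    by apply: eq_integral => x _; rewrite integral_indic// setIT.
  rewrite invP// integral_mkcond; apply: eq_integral => x _.
  by rewrite /patch indicE; case: ifPn; rewrite ?mule1// mule0.
Qed.

Let swap_op_invariant_ge0 (g : T -> R) (c : R) : measurable_fun setT g ->
  (forall x, 0 <= g x <= c) ->
  bounded_meas (swap_op u P acc Lq g) /\ Lp (swap_op u P acc Lq g) = Lp g.
Proof.
move=> mg gc; have g0 x : 0 <= g x by case/andP: (gc x).
have bg : bounded_meas g.
  by split=> //; exists c => x; have /andP[? ?] := gc x; rewrite ger0_norm.
have ba := bm_acc acc01 macc.
have bag x : bounded_meas (fun y => acc x y * g y) by apply: bmM.
have a0 x y : 0 <= acc x y by case/andP: (acc01 x y).
have mF (k : T -> R) : measurable_fun setT k -> (forall x, 0 <= k x) ->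
    measurable_fun setT (fun x => \int[mu]_y (acc x y * k y * q y)%:E : \bar R)%E.
  move=> mk k0.
  pose smu : {sigma_finite_measure set T -> \bar R} := as_sigma_finite sf.
  have h := @measurable_fun_fubini_tonelli_F _ _ T T R smu
    (fun z : T * T => (acc z.1 z.2 * k z.2 * q z.2)%:E).
  apply: h.
    apply/measurable_EFinP; repeat apply: measurable_funM => //;
    exact: measurableT_comp.
  by move=> z; rewrite lee_fin !mulr_ge0.
pose A x := Lq (fun y => acc x y * g y).
pose a x := Lq (acc x).
pose Pg x := \int[P x]_y g y.
have AE x : ((A x)%:E = \int[mu]_y (acc x y * g y * q y)%:E)%E.
  rewrite /A /Lq /Rintegral fineK//.
  exact: (integrable_fin_num measurableT (int_bm intq q0 (bag x))).
have aE x : ((a x)%:E = \int[mu]_y (acc x y * 1 * q y)%:E)%E.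
  under eq_integral do rewrite mulr1.
  rewrite /a /Lq /Rintegral fineK//.
  exact: (integrable_fin_num measurableT (int_bm intq q0 (ba x))).
have PgE x : ((Pg x)%:E = \int[P x]_y (g y)%:E)%E.
  by rewrite (EFin_bm (prob_kernel x)).
have A01 x : 0 <= A x <= c.
  rewrite Rintegral_ge0/=; last by move=> y _; rewrite !mulr_ge0.
  rewrite -[leRHS](av_cst avq c); apply: (av_le avq).
  - exact/bd/bag.
  - exact/bd/bm_cst.
  - move=> y; have /andP[_ a1] := acc01 x y; have /andP[_ gyc] := gc y.
    by rewrite -[leRHS]mul1r ler_pM.
have a01 x : 0 <= a x <= 1.
  rewrite Rintegral_ge0/=; last by move=> y _; rewrite !mulr_ge0.
  rewrite -[leRHS](av_cst avq 1); apply: (av_le avq).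
  - exact/bd/ba.
  - exact/bd/bm_cst.
  - by move=> y; case/andP: (acc01 x y).
have Pg01 x : 0 <= Pg x <= c.
  rewrite Rintegral_ge0//= -[leRHS](bm_int_cst (prob_kernel (s := P) x) c).
  apply: (bm_le_int (prob_kernel x)) => //; first exact: bm_cst.
  by move=> y; case/andP: (gc y).
have bA : bounded_meas A.
  split; last by exists c => x; have /andP[? ?] := A01 x; rewrite ger0_norm.
  by apply/measurable_EFinP; rewrite /comp; under eq_fun do rewrite AE; exact: mF.
have ba' : bounded_meas a.
  split; last by exists 1 => x; have /andP[? ?] := a01 x; rewrite ger0_norm.
  apply/measurable_EFinP; rewrite /comp; under eq_fun do rewrite aE.
  by apply: (mF (fun=> 1)) => //; exact: measurable_cst.
have bPg : bounded_meas Pg.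
  split; last by exists c => x; have /andP[? ?] := Pg01 x; rewrite ger0_norm.
  apply/measurable_EFinP; rewrite /comp; under eq_fun do rewrite PgE.
  apply: measurable_fun_integral_kernel => [B|y|]; first exact: measurable_kernel.
    by rewrite lee_fin.
  exact/measurable_EFinP.
have bga : bounded_meas (fun x => g x * a x) by exact: bmM.
have bg' : bounded_meas (fun x => g x - g x * a x) by exact: bmB.
have bA' : bounded_meas (fun x => A x + (g x - g x * a x)) by exact: bmD.
have opE : swap_op u P acc Lq g =
    (fun x => (1 - u) * Pg x + u * (A x + (g x - g x * a x))).
  by apply/funext => x; rewrite (swap_op_split v0_gt0 v0V u P acc01 macc avq).
have b1 : bounded_meas (fun x => (1 - u) * Pg x).
  by apply: bmM => //; exact: bm_cst.
have b2 : bounded_meas (fun x => u * (A x + (g x - g x * a x))).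
  by apply: bmM => //; exact: bm_cst.
split; first by rewrite opE; exact: bmD.
rewrite opE (avD avp (bd b1) (bd b2)) (avZ avp _ (bd bPg)) (avZ avp _ (bd bA')).
rewrite (avD avp (bd bA) (bd bg')) (avB avp (bd bg) (bd bga)).
have -> : Lp Pg = Lp g.
  congr fine; transitivity (\int[mu]_x ((p x)%:E * \int[P x]_y (g y)%:E))%E.
    by apply: eq_integral => x _; rewrite EFinM muleC -PgE.
  rewrite kernel_integral_invariant.
    by apply: eq_integral => x _; rewrite -EFinM mulrC.
  by split=> [|x]; [exact/measurable_EFinP|rewrite lee_fin].
have -> : Lp A = Lp (fun x => g x * a x).
  have pull x (k : T -> R) : measurable_fun setT k -> (forall y, 0 <= k y) ->
    ((p x)%:E * \int[mu]_y (acc x y * k y * q y)%:E =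
     \int[mu]_y (p x * q y * acc x y * k y)%:E)%E.
    move=> mk k0; rewrite -ge0_integralZl//.
    - by apply: eq_integral => y _; rewrite -EFinM; congr EFin; ring.
    - apply/measurable_EFinP; apply: measurable_funM => //.
      by apply: measurable_funM => //; exact: (ba x).1.
    - by move=> y _; rewrite lee_fin !mulr_ge0.
    - by rewrite lee_fin.
  have mc c' : measurable_fun setT (fun _ : T => c' : R) by exact: measurable_cst.
  congr fine.
  transitivity (\int[mu]_x \int[mu]_y (p x * q y * acc x y * g y)%:E)%E.
    by apply: eq_integral => x _; rewrite EFinM muleC AE pull.
  have := @swap_detailed_balance _ _ _ (as_sigma_finite sf) p q g acc.
  move=> /(_ mp mq mg macc p0 q0 g0 a0 sym) /= ->.
  apply: eq_integral => x _; rewrite EFinM muleC EFinM aE muleCA pull//.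
  rewrite -ge0_integralZl//.
  - by apply: eq_integral => y _; rewrite -EFinM; congr EFin; ring.
  - apply/measurable_EFinP; apply: measurable_funM => //.
    by apply: measurable_funM; [exact: measurable_funM|exact: (ba x).1].
  - by move=> y _; rewrite lee_fin !mulr_ge0.
  - by rewrite lee_fin.
ring.
Qed.

Let swap_op_shifted g M x : bounded_meas g ->
  swap_op u P acc Lq (fun z => g z + M) x = swap_op u P acc Lq g x + M.
Proof.
move=> bg; rewrite (swap_opD v0_gt0 v0V u P acc01 macc avq)//.
  by rewrite (swap_op_cst u P acc avq).
exact: bm_cst.
Qed.

Lemma bm_swap_op g : bounded_meas g -> bounded_meas (swap_op u P acc Lq g).
Proof.
move=> bg; have [mg [M gM]] := bg.
have [] := @swap_op_invariant_ge0 (fun z => g z + M) (2 * M).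
- exact: measurable_funD.
- by move=> z; have := gM z; rewrite ler_norml => /andP[? ?]; apply/andP; split; lra.
move=> b _; rewrite (_ : swap_op _ _ _ _ _ =
    (fun x => swap_op u P acc Lq (fun z => g z + M) x - M)).
  by apply: bmB => //; exact: bm_cst.
by apply/funext => x; rewrite swap_op_shifted// addrK.
Qed.

(** [P] preserves the density [p], and the swaps do so by detailed balance. *)
Lemma swap_op_invariant g : bounded_meas g ->
  Lp (swap_op u P acc Lq g) = Lp g.
Proof.
move=> bg; have [mg [M gM]] := bg.
have [] := @swap_op_invariant_ge0 (fun z => g z + M) (2 * M).
- exact: measurable_funD.
- by move=> z; have := gM z; rewrite ler_norml => /andP[? ?]; apply/andP; split; lra.
move=> _; have bM := bm_cst T M.
rewrite (avD avp (bd bg) (bd bM)) (av_cst avp).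
have -> : swap_op u P acc Lq (fun z => g z + M) =
    (fun x => swap_op u P acc Lq g x + M).
  by apply/funext => x; rewrite swap_op_shifted.
rewrite (avD avp (bd (bm_swap_op bg)) (bd bM)) (av_cst avp); lra.
Qed.

End invariant_swap_operator.

(** * The acceptance probability *)

Lemma continuous_borel_measurable (R : realType) (X : ptopologicalType)
    (f : X -> R) : continuous f -> measurable_fun setT (f : borel X -> R).
Proof.
move=> /continuousP cf; apply: (measurability _ (RGenOpens.measurableE R)).
move=> _ [_ [a [b ->] <-]]; rewrite setTI; apply: sub_sigma_algebra.
exact/cf/interval_open.
Qed.

Lemma continuous_powR_comp (R : realType) (X : topologicalType) (f : X -> R) c :
  continuous f -> (forall x, 0 < f x) -> continuous (fun x => f x `^ c).
Proof.
move=> cf f0 x.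
rewrite (_ : (fun x => f x `^ c) = (fun x => expR (c * ln (f x)))); last first.
  by apply/funext => z; rewrite /powR gt_eqF.
apply: (@continuous_comp _ _ _ (fun z => c * ln (f z)) expR); last first.
  exact: continuous_expR.
apply: (@continuous_comp _ _ _ (fun z => ln (f z)) ( *%R c)); last first.
  exact: mulrl_continuous.
apply: (@continuous_comp _ _ _ f (@ln R)); first exact: cf.
exact: continuous_ln.
Qed.

Section acceptance.
Context (R : realType) (X : ptopologicalType).
Variables (pi : X -> R) (M : R) (b : R).
Hypotheses (pi_cont : continuous pi) (pi0 : forall x, 0 < pi x)
  (piM : forall x, pi x <= M) (b0 : 0 < b).

(** The acceptance probability of a proposal [y] is
    [1 /\ (pi y / pi x) `^ b]. With [tau = pi x `^ b] it is written without
    division by [tau], and it extends continuously by 1 to [tau = 0]. *)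
Definition accept_at (tau : R) (y : X) : R :=
  pi y `^ b / Num.max tau (pi y `^ b).

Definition accept (x y : X) : R := accept_at (pi x `^ b) y.

Let w0 y : 0 < pi y `^ b. Proof. by rewrite powR_gt0. Qed.

Let m0 (tau : R) y : 0 < Num.max tau (pi y `^ b).
Proof. by rewrite lt_max w0 orbT. Qed.

Lemma accept_at01 tau y : 0 <= accept_at tau y <= 1.
Proof.
by rewrite divr_ge0 ?(ltW (w0 _)) ?(ltW (m0 _ _))//= ler_pdivrMr// mul1r
  le_max lexx orbT.
Qed.

Lemma accept01 x y : 0 <= accept x y <= 1. Proof. exact: accept_at01. Qed.

(** The key estimate: as [pi] is bounded by [M], the acceptance probability has
    a positive lower bound that does not depend on the current state. *)
Lemma accept_lower x y : 0 <= pi y `^ b / M `^ b <= accept x y.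
Proof.
have M0 : 0 < M by apply: lt_le_trans (pi0 x) (piM x).
have Mb : 0 < M `^ b by rewrite powR_gt0.
rewrite divr_ge0 ?(ltW Mb) ?(ltW (w0 _))//= ler_wpM2l ?(ltW (w0 _))//.
rewrite lef_pV2 ?posrE// ge_max.
by rewrite !ge0_ler_powR ?nnegrE ?(ltW b0) ?(ltW (pi0 _)) ?(ltW M0).
Qed.

Lemma continuous_accept_at tau : continuous (accept_at tau).
Proof.
have cw : continuous (fun y => pi y `^ b) by exact: continuous_powR_comp.
move=> y; apply: cvgM; first exact: cw.
apply: cvgV; first by rewrite gt_eqF.
apply: (@continuous_max R X (fun=> tau) (fun y => pi y `^ b) y).
  exact: cvg_cst.
exact: cw.
Qed.

Lemma measurable_accept :
  measurable_fun setT (fun z : borel X * borel X => accept z.1 z.2).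
Proof.
have mpi : measurable_fun setT (fun x : borel X => pi x `^ b).
  by apply: continuous_borel_measurable; exact: continuous_powR_comp.
have m1 : measurable_fun setT (fun z : borel X * borel X => pi z.1 `^ b).
  exact: (measurableT_comp mpi measurable_fst).
have m2 : measurable_fun setT (fun z : borel X * borel X => pi z.2 `^ b).
  exact: (measurableT_comp mpi measurable_snd).
apply: measurable_funM => //.
under eq_fun do rewrite -[_^-1]powR_inv1 ?(ltW (m0 _ _))//.
apply: (measurableT_comp (measurable_powR _)).
exact: measurable_maxr.
Qed.

(** Hoelder rather than Lipschitz continuity in [tau]: a small exponent [r]
    keeps the constant [pi y `^ (- (b * r))] integrable. *)
Lemma accept_at_holder (r tau tau' : R) y : 0 < r <= 1 -> 0 < tau -> 0 < tau' ->
  `|accept_at tau y - accept_at tau' y| <=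
    `|tau - tau'| `^ r * pi y `^ (- (b * r)).
Proof.
move=> /andP[r0 r1] t0 t0'.
set w := pi y `^ b; have w0' : 0 < w by exact: w0.
have -> : `|tau - tau'| `^ r * pi y `^ (- (b * r)) = (`|tau - tau'| / w) `^ r.
  have wi : w^-1 `^ r = (w `^ r)^-1.
    by rewrite -powR_inv1 ?(ltW w0')// -powRrM mulN1r powRN.
  by rewrite powRM ?invr_ge0 ?(ltW w0')// wi powRN powRrM.
set z := `|tau - tau'| / w.
have z0 : 0 <= z by rewrite divr_ge0 ?(ltW w0').
have le1 : `|accept_at tau y - accept_at tau' y| <= 1.
  have /andP[? ?] := accept_at01 tau y; have /andP[? ?] := accept_at01 tau' y.
  by rewrite ler_norml; apply/andP; split; lra.
have lez : `|accept_at tau y - accept_at tau' y| <= z.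
  rewrite /accept_at -/w; set a := Num.max tau w; set a' := Num.max tau' w.
  have a0 : 0 < a by exact: m0.
  have a0' : 0 < a' by exact: m0.
  have wa : w <= a by rewrite /a le_max lexx orbT.
  have wa' : w <= a' by rewrite /a' le_max lexx orbT.
  have aa : `|a' - a| <= `|tau - tau'|.
    rewrite distrC /a /a' !maxEle.
    have := ler_norm (tau - tau'); have := lerNnormlW (lexx (`|tau - tau'|)).
    by case: (leP tau w) => ?; case: (leP tau' w) => ? h1 h2;
      rewrite ?subrr ?normr0// ler_norml; apply/andP; split; lra.
  have -> : w / a - w / a' = (a' - a) * (w / (a * a')).
    by field; rewrite !gt_eqF.
  rewrite normrM /z (ger0_norm (_ : 0 <= w / (a * a'))); last first.
    by rewrite divr_ge0 ?mulr_ge0 ?ltW.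
  have h : w / (a * a') <= w^-1.
    rewrite ler_pdivrMr ?mulr_gt0// mulrC ler_pdivlMr//.
    by rewrite ler_pM// ltW.
  by apply: ler_pM => //; rewrite divr_ge0 ?mulr_ge0 ?ltW.
have [z1|z1] := leP 1 z.
  apply: (le_trans le1).
  have : 1 `^ r <= z `^ r by apply: ge0_ler_powR; rewrite ?nnegrE ?(ltW r0).
  by rewrite powR1.
apply: (le_trans lez); have [->|zn0] := eqVneq z 0; first exact: powR_ge0.
by apply: ger1_powR => //; rewrite lt_neqAle eq_sym zn0 z0 ltW.
Qed.

Lemma small_powR (eps C r : R) : 0 < eps -> 0 <= C -> 0 < r ->
  exists2 delta, 0 < delta &
    forall z, 0 <= z <= delta -> z `^ r * C <= eps.
Proof.
move=> e0 C0 r0; have C1 : 0 < C + 1 by rewrite ltr_wpDl.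
have q0 : 0 < eps / (C + 1) by rewrite divr_gt0.
exists ((eps / (C + 1)) `^ r^-1); first by rewrite powR_gt0.
move=> z /andP[z0 zd].
have : z `^ r <= eps / (C + 1).
  have -> : eps / (C + 1) = ((eps / (C + 1)) `^ r^-1) `^ r.
    by rewrite -powRrM mulVf ?gt_eqF// powRr1// ltW.
  by apply: ge0_ler_powR; rewrite ?nnegrE ?powR_ge0 ?(ltW r0).
move=> h; apply: (@le_trans _ _ (eps / (C + 1) * (C + 1))).
  by apply: ler_pM; rewrite ?powR_ge0// lerDl.
by rewrite divfK// gt_eqF.
Qed.

Lemma bm_accept_at (tau : R) :
  @bounded_meas R _ (borel X) (accept_at tau).
Proof.
split; first by apply: continuous_borel_measurable; exact: continuous_accept_at.
by exists 1 => y; have /andP[? ?] := accept_at01 tau y; rewrite ger0_norm.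
Qed.

Section averaged_acceptance.
Variables (V : borel X -> R) (v0 r : R).
Hypotheses (v0_gt0 : 0 < v0) (v0V : forall x, v0 <= V x).
Hypotheses (r01 : 0 < r <= 1).
Let Vr (y : borel X) := pi y `^ (- (b * r)).
Hypothesis dVr : dominated V Vr.
Variables (f : borel X -> R) (c : R).
Hypotheses (mf : measurable_fun setT f) (fc : forall y, `|f y| <= c).

Let bf : bounded_meas f. Proof. by split=> //; exists c. Qed.
Let c0 : 0 <= c. Proof. exact: le_trans (fc point). Qed.

Let daf tau : dominated V (fun y => accept_at tau y * f y).
Proof. by apply: (dom_bm v0_gt0 v0V); apply: bmM => //; exact: bm_accept_at. Qed.

Lemma averaging_accept_holder (theta : (borel X -> R) -> R) (tau tau' : R) :
  averaging V theta -> 0 < tau -> 0 < tau' ->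
  `|theta (fun y => accept_at tau y * f y) -
    theta (fun y => accept_at tau' y * f y)| <=
  `|tau - tau'| `^ r * (c * theta Vr).
Proof.
move=> av t0 t0'; rewrite -(avB av)// -!(avZ av)//; last exact: domZ.
apply: (av_norm_le av); first exact: domB.
  by apply: domZ; exact: domZ.
move=> y; rewrite -mulrBl normrM mulrCA mulrC.
by apply: ler_pM => //; exact: accept_at_holder.
Qed.

Lemma continuous_averaging_accept (theta : (borel X -> R) -> R) :
  averaging V theta ->
  continuous (fun x : X => theta (fun y => accept x y * f y)).
Proof.
move=> av x.
have tV0 : 0 <= theta Vr.
  rewrite -(av_cst av 0); apply: (av_le av) => //.
    by apply: (dom_bm v0_gt0 v0V); exact: bm_cst.
  by move=> y; exact: powR_ge0.
apply/cvgrPdist_le => eps eps0.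
have r0 : 0 < r by case/andP: r01.
have [delta d0 hd] := small_powR eps0 (mulr_ge0 c0 tV0) r0.
have /cvgrPdist_le /(_ _ d0) : pi x' `^ b @[x' --> x] --> pi x `^ b.
  exact: continuous_powR_comp.
apply: filterS => x' hx'.
apply: (le_trans (averaging_accept_holder av (w0 x) (w0 x'))).
by apply: hd; rewrite normr_ge0.
Qed.

(** On a mesh of width [M `^ b / m.+1] the Hoelder bound transfers the
    convergence from the mesh to all of ]0, M `^ b], uniformly because
    [theta_ n Vr] stays bounded. *)
Lemma uniform_averaging_accept (theta_ : nat -> (borel X -> R) -> R)
    (theta : (borel X -> R) -> R) B :
  (forall n, averaging V (theta_ n)) -> averaging V theta ->
  (forall n, theta_ n Vr <= B) ->
  (forall m i : nat, let tau := i.+1%:R * (M `^ b / m.+1%:R) in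
    theta_ n (fun y => accept_at tau y * f y) @[n --> \oo] -->
      theta (fun y => accept_at tau y * f y)) ->
  forall eps, 0 < eps -> \forall n \near \oo, forall x : X,
    `|theta_ n (fun y => accept x y * f y) -
      theta (fun y => accept x y * f y)| <= eps.
Proof.
move=> avn av hB hcvg eps eps0.
have M0 : 0 < M by apply: lt_le_trans (pi0 point) (piM point).
have Mb : 0 < M `^ b by rewrite powR_gt0.
have r0 : 0 < r by case/andP: r01.
have tV0 th : averaging V th -> 0 <= th Vr.
  move=> avt; rewrite -(av_cst avt 0); apply: (av_le avt) => //.
    by apply: (dom_bm v0_gt0 v0V); exact: bm_cst.
  by move=> y; exact: powR_ge0.
have B0 : 0 <= B := le_trans (tV0 _ (avn 0%N)) (hB 0%N).
have e30 : 0 < eps / 3 by rewrite divr_gt0.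
pose D := c * (B + theta Vr).
have D0 : 0 <= D by rewrite mulr_ge0// addr_ge0// tV0.
have [delta d0 hd] := small_powR e30 D0 r0.
pose m := Num.truncn (M `^ b / delta).
pose h := M `^ b / m.+1%:R.
have h0 : 0 < h by rewrite divr_gt0.
have hdelta : h <= delta.
  rewrite /h ler_pdivrMr// mulrC -ler_pdivrMr//.
  exact/ltW/truncnS_gt.
have near_mesh k : \forall n \near \oo, forall i, (i < k)%N ->
    `|theta_ n (fun y => accept_at (i.+1%:R * h) y * f y) -
      theta (fun y => accept_at (i.+1%:R * h) y * f y)| <= eps / 3.
  elim: k => [|k ih]; first by apply: nearW.
  have /cvgrPdist_le/(_ _ e30) := hcvg m k.
  apply: filterS2 ih => n ih hk i; rewrite ltnS leq_eqVlt => /predU1P[->|].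
    by rewrite distrC.
  exact: ih.
apply: filterS (near_mesh m.+2) => n hn x.
pose tau := pi x `^ b; have tau0 : 0 < tau by exact: w0.
have tauM : tau <= M `^ b.
  by apply: ge0_ler_powR; rewrite ?nnegrE ?(ltW b0) ?(ltW M0) ?(ltW (pi0 _)).
(* The mesh point just above [tau]; [tau = M `^ b] has index [m.+1], which is why
   the mesh runs over [m.+2] indices. *)
pose i := Num.truncn (tau / h).
have i_le : i%:R <= tau / h by rewrite Num.Theory.truncn_le divr_ge0 ?ltW.
have i_gt : tau / h < i.+1%:R by exact: truncnS_gt.
have im : (i < m.+2)%N.
  rewrite -(ltr_nat R); apply: (le_lt_trans i_le).
  apply: (@le_lt_trans _ _ m.+1%:R); last by rewrite ltr_nat.
  rewrite ler_pdivrMr// /h mulrC divfK// gt_eqF//.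
pose tau' := i.+1%:R * h; have tau'0 : 0 < tau' by rewrite mulr_gt0.
have dist : `|tau - tau'| <= delta.
  apply: le_trans hdelta.
  have e : tau = tau / h * h by rewrite divfK// gt_eqF.
  rewrite ler_norml {1 2}e /tau' -mulrBl; apply/andP; split.
    rewrite lerNl -mulNr -[leRHS]mul1r ler_wpM2r ?(ltW h0)//.
    by rewrite -natr1; lra.
  rewrite -[leRHS]mul1r ler_wpM2r ?(ltW h0)//.
  by rewrite -natr1; lra.
have close th : averaging V th -> th Vr <= B + theta Vr ->
    `|th (fun y => accept x y * f y) -
      th (fun y => accept_at tau' y * f y)| <= eps / 3.
  move=> avt hth; apply: (le_trans (averaging_accept_holder avt tau0 tau'0)).
  apply: (le_trans _ (hd `|tau - tau'| _)); last by rewrite normr_ge0.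
  by rewrite ler_wpM2l ?powR_ge0// ler_wpM2l.
have c1 : `|theta_ n (fun y => accept x y * f y) -
    theta_ n (fun y => accept_at tau' y * f y)| <= eps / 3.
  by apply: close => //; rewrite (le_trans (hB n))// lerDl tV0.
have c2 : `|theta (fun y => accept x y * f y) -
    theta (fun y => accept_at tau' y * f y)| <= eps / 3.
  by apply: close => //; rewrite lerDr.
have c3 := hn i im.
move: c1 c2 c3.
set a := theta_ n _; set a' := theta_ n _; set t := theta _; set t' := theta _.
rewrite !ler_norml => /andP[? ?] /andP[? ?] /andP[? ?].
by apply/andP; split; lra.
Qed.

End averaged_acceptance.

End acceptance.

(** * Tempered densities *)

Section gibbs.
Context (R : realType) (X : ptopologicalType).
Variables (mu : {measure set (borel X) -> \bar R}) (pi : X -> R) (M : R).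
Hypotheses (pi_cont : continuous pi) (pi0 : forall x, 0 < pi x)
  (piM : forall x, pi x <= M).

Let M0 : 0 < M. Proof. exact: lt_le_trans (pi0 point) (piM point). Qed.

Lemma powR_le_bound (a c : R) x : c <= a -> pi x `^ a <= M `^ (a - c) * pi x `^ c.
Proof.
move=> ca; have -> : pi x `^ a = pi x `^ (a - c) * pi x `^ c.
  by rewrite -powRD ?subrK// (gt_eqF (pi0 x)) implybT.
rewrite ler_wpM2r ?powR_ge0//.
by apply: ge0_ler_powR;
  rewrite ?nnegrE ?subr_ge0 ?(ltW (pi0 x)) ?(ltW M0).
Qed.

Lemma measurable_pi_powR (a : R) :
  measurable_fun setT (fun x : borel X => pi x `^ a).
Proof. by apply: continuous_borel_measurable; exact: continuous_powR_comp. Qed.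

Lemma powR_tail_finite (kap a : R) : kap <= a ->
  (\int[mu]_x (pi x `^ kap)%:E < +oo)%E -> (\int[mu]_x (pi x `^ a)%:E < +oo)%E.
Proof.
move=> ka fin.
apply: (@le_lt_trans _ _ (\int[mu]_x ((M `^ (a - kap))%:E * (pi x `^ kap)%:E))%E).
  apply: ge0_le_integral => //.
  - by move=> x _; rewrite lee_fin powR_ge0.
  - by apply/measurable_EFinP; exact: measurable_pi_powR.
  - apply: measurable_funeM; apply/measurable_EFinP; exact: measurable_pi_powR.
  - by move=> x _; rewrite -EFinM lee_fin powR_le_bound.
rewrite ge0_integralZl ?lte_mul_pinfty ?lee_fin ?powR_ge0//.
- by apply/measurable_EFinP; exact: measurable_pi_powR.
- by move=> x _; rewrite lee_fin powR_ge0.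
Qed.

Lemma powR_integrable (a : R) : (\int[mu]_x (pi x `^ a)%:E < +oo)%E ->
  mu.-integrable setT (fun x : borel X => (pi x `^ a)%:E).
Proof.
move=> fin; apply/integrableP; split.
  by apply/measurable_EFinP; exact: measurable_pi_powR.
by under eq_integral do rewrite gee0_abs ?lee_fin ?powR_ge0//.
Qed.

(** If a power of [pi] had integral 0 it would vanish almost everywhere, and so
    would [pi], whose integral is 1. *)
Lemma powR_integral_gt0 (a : R) : (\int[mu]_x (pi x)%:E = 1)%E ->
  (\int[mu]_x (pi x `^ a)%:E < +oo)%E -> 0 < \int[mu]_x (pi x `^ a).
Proof.
move=> pi1 fin; rewrite lt_neqAle Rintegral_ge0 ?andbT; last first.
  by move=> x _; exact: powR_ge0.
apply/eqP => int0.
have mpi : measurable_fun setT (fun x : borel X => pi x).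
  exact: continuous_borel_measurable.
have : (\int[mu]_x `|(pi x `^ a)%:E| = 0)%E.
  under eq_integral do rewrite gee0_abs ?lee_fin ?powR_ge0//.
  rewrite -[LHS]fineK ?ge0_fin_numE//; first by congr EFin; exact: esym int0.
  by apply: integral_ge0 => x _; rewrite lee_fin powR_ge0.
move/(ae_eq_integral_abs mu measurableT); move=> h.
have {}h : ae_eq mu setT (fun x : borel X => (pi x)%:E) (cst 0%E).
  have mpa : measurable_fun setT (fun x : borel X => (pi x `^ a)%:E).
    by apply/measurable_EFinP; exact: measurable_pi_powR.
  apply: filterS (h mpa) => x /(_ I) /= [/eqP].
  by rewrite gt_eqF// powR_gt0.
have mpE : measurable_fun setT (fun x : borel X => (pi x)%:E).
  exact/measurable_EFinP.
have /(ae_eq_integral_abs mu measurableT mpE) := h.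
under eq_integral do rewrite gee0_abs ?lee_fin ?(ltW (pi0 _))//.
by rewrite pi1 => /eqP; rewrite eqe oner_eq0.
Qed.

Definition gibbs (a : R) (x : borel X) : R :=
  pi x `^ a / \int[mu]_y (pi y `^ a).

Hypothesis pi1 : (\int[mu]_x (pi x)%:E = 1)%E.
Variables (kap t : R).
Hypotheses (t_gt0 : 0 < t) (tail : (\int[mu]_x (pi x `^ kap)%:E < +oo)%E).

Definition weight (s : R) (x : borel X) : R := pi x `^ (- s).

Lemma weight_ge0 s x : 0 <= weight s x. Proof. exact: powR_ge0. Qed.

Lemma measurable_weight s : measurable_fun setT (weight s).
Proof. exact: measurable_pi_powR. Qed.

Lemma weight_lower s x : 0 <= s -> M `^ (- s) <= weight s x.
Proof.
move=> s0; rewrite /weight !powRN lef_pV2 ?posrE ?powR_gt0//.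
by apply: ge0_ler_powR; rewrite ?nnegrE ?(ltW (pi0 x)) ?(ltW M0).
Qed.

Lemma weight_le s s' x : s <= s' -> weight s x <= M `^ (s' - s) * weight s' x.
Proof.
move=> ss; have := @powR_le_bound (- s) (- s') x.
by rewrite lerN2 opprK addrC; apply.
Qed.

Section normalised.
Variable a : R.
Hypothesis kta : kap + t <= a.

Let afin : (\int[mu]_x (pi x `^ a)%:E < +oo)%E.
Proof. by apply: powR_tail_finite tail; move: kta t_gt0; lra. Qed.

Lemma normaliser_gt0 : 0 < \int[mu]_x (pi x `^ a).
Proof. exact: powR_integral_gt0. Qed.

Lemma gibbs_ge0 x : 0 <= gibbs a x.
Proof. by rewrite divr_ge0 ?powR_ge0 ?ltW ?normaliser_gt0. Qed.

Lemma measurable_gibbs : measurable_fun setT (gibbs a).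
Proof. by apply: measurable_funM => //; exact: measurable_pi_powR. Qed.

Lemma gibbs_integral : \int[mu]_x gibbs a x = 1.
Proof.
rewrite RintegralZr//; last exact: powR_integrable.
by rewrite mulfV// gt_eqF// normaliser_gt0.
Qed.

Lemma gibbs_integrable : mu.-integrable setT (EFin \o gibbs a).
Proof.
rewrite (_ : EFin \o gibbs a = (fun x => ((\int[mu]_y (pi y `^ a))^-1)%:E *
  (pi x `^ a)%:E)%E).
  by apply: integrableZl => //; exact: powR_integrable.
by apply/funext => x /=; rewrite /gibbs mulrC.
Qed.

Lemma weight_gibbs_finite s : s <= t ->
  (\int[mu]_x (weight s x * gibbs a x)%:E < +oo)%E.
Proof.
move=> st; have Z0 := normaliser_gt0.
under eq_integral => x _.
  rewrite (_ : (weight s x * gibbs a x)%:E =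
    ((\int[mu]_y (pi y `^ a))^-1)%:E * (pi x `^ (a - s))%:E)%E; last first.
    rewrite -EFinM /weight /gibbs; congr EFin.
    by rewrite addrC powRD ?(gt_eqF (pi0 x)) ?implybT//; ring.
  over.
rewrite ge0_integralZl ?lte_mul_pinfty ?lee_fin ?invr_ge0 ?(ltW Z0)//.
- by apply: powR_tail_finite tail; move: kta; lra.
- by apply/measurable_EFinP; exact: measurable_pi_powR.
- by move=> x _; rewrite lee_fin powR_ge0.
Qed.

Lemma averaging_gibbs s : 0 <= s <= t ->
  averaging (weight s) (fun f => \int[mu]_x (f x * gibbs a x)).
Proof.
move=> /andP[s0 st].
apply: (@averaging_density _ _ _ (weight s) (M `^ (- s))).
- exact: measurable_weight.
- by rewrite powR_gt0.
- by move=> x; exact: weight_lower.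
- exact: measurable_gibbs.
- exact: gibbs_ge0.
- exact: weight_gibbs_finite.
- exact: gibbs_integral.
Qed.

End normalised.

End gibbs.

(** * The Poisson equation along a path *)

Section real_sequences.
Variable R : realType.
Implicit Types a b : nat -> R.

Lemma cvg0_dominated a b : (forall n, `|a n| <= b n) ->
  b @ \oo --> (0 : R) -> a @ \oo --> (0 : R).
Proof.
move=> ab /cvgrPdist_le hb; apply/cvgrPdist_le => e e0.
apply: filterS (hb e e0) => n; rewrite !sub0r !normrN.
by apply: le_trans; exact: le_trans (ab n) (ler_norm _).
Qed.

Lemma cvg_ubound a l : a @ \oo --> (l : R) -> exists B, forall n, a n <= B.
Proof.
move=> /cvgP/cvg_seq_bounded [B [_ hB]].
exists (B + 1) => n; apply: (le_trans (ler_norm _)).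
by apply: hB => //; rewrite ltrDl.
Qed.

(** Shifting the index turns the sum of [F - RF] along [x] into a bounded
    boundary term, the martingale part of the increments of [F], and the errors
    made by replacing the one-step means [Q n] by [RF (x n)], which a Cesaro
    mean sends to 0. *)
Lemma poisson_path d (T : measurableType d) (F RF : T -> R) (x : nat -> T)
    (Q : nat -> R) (c : R) :
  (forall z, `|F z| <= c) ->
  n%:R^-1 * (\sum_(0 <= i < n) (F (x i.+1) - Q i)) @[n --> \oo] --> (0 : R) ->
  Q n - RF (x n) @[n --> \oo] --> (0 : R) ->
  empirical n x (fun z => F z - RF z) @[n --> \oo] --> (0 : R).
Proof.
move=> Fc hS hd.
pose S n := \sum_(0 <= i < n) (F (x i.+1) - Q i).
have -> : (fun n => empirical n x (fun z => F z - RF z)) =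
    (fun n => (n.+1%:R^-1 * (F (x 0%N) - F (x n.+1)) + n.+1%:R^-1 * S n.+1) +
      arithmetic_mean (fun n => Q n - RF (x n)) n).
  apply/funext => n.
  rewrite /arithmetic_mean /= /empirical -!mulrDr; congr (_ * _).
  have -> : F (x 0%N) - F (x n.+1) = \sum_(0 <= i < n.+1) (F (x i) - F (x i.+1)).
    elim: n => [|n ih]; first by rewrite big_nat1.
    by rewrite big_nat_recr//= -ih; ring.
  rewrite /series /= /S.
  rewrite -!big_split/=; apply: eq_bigr => i _; ring.
rewrite (_ : (0 : R) = 0 + 0 + 0); last by rewrite !addr0.
apply: cvgD; last exact: cesaro.
apply: cvgD; last first.
  by have := @cvg_shiftS _ (fun n => n%:R^-1 * S n) (nbhs (0 : R)); move=> ->.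
apply: (@cvg0_dominated _ (fun n => 2 * c * n.+1%:R^-1)).
  move=> n; rewrite normrM [leLHS]mulrC [X in _ * X]gtr0_norm ?invr_gt0//.
  rewrite ler_wpM2r ?invr_ge0// (le_trans (ler_normB _ _))//.
  by have := Fc (x 0%N); have := Fc (x n.+1); lra.
rewrite -(mulr0 (2 * c)).
by apply: cvgMr; exact: cvg_harmonic.
Qed.

End real_sequences.

(** * The law of large numbers at one level *)

Section level.
Context (R : realType) (X : ptopologicalType).
Variables (mu : {measure set (borel X) -> \bar R}) (pi : X -> R) (M : R).
Hypotheses (pi_cont : continuous pi) (pi0 : forall x, 0 < pi x)
  (piM : forall x, pi x <= M) (pi1 : (\int[mu]_x (pi x)%:E = 1)%E).
Variables (kap t e e' u : R) (P : R.-pker borel X ~> borel X).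
Hypotheses (t_gt0 : 0 < t) (tail : (\int[mu]_x (pi x `^ kap)%:E < +oo)%E).
Hypotheses (kte' : kap + t <= e') (te' : t < e') (e'e : e' < e) (u01 : 0 < u < 1).
Hypothesis fellerP : feller P.
Hypothesis invP : invariant_density mu (gibbs mu pi e) P.
Hypothesis driftP : forall s, 0 < s < e -> exists lam b : R, 0 < lam < 1 /\
  forall x, (\int[P x]_y (weight pi s y)%:E <= (lam * weight pi s x + b)%:E)%E.

Let b := e - e'.
Let b_gt0 : 0 < b. Proof. by rewrite subr_gt0. Qed.
Let acc : borel X -> borel X -> R := accept pi b.
Let acc01 := accept01 (pi := pi) b pi0.
Let macc := measurable_accept b pi_cont pi0.
Let Lp (f : borel X -> R) := \int[mu]_x (f x * gibbs mu pi e x).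
Let Lq (f : borel X -> R) := \int[mu]_x (f x * gibbs mu pi e' x).
Let M_gt0 : 0 < M. Proof. exact: lt_le_trans (pi0 point) (piM point). Qed.

Let kte : kap + t <= e. Proof. by move: kte' e'e; lra. Qed.

Let avp s : 0 <= s <= t -> averaging (weight pi s) Lp.
Proof. exact: (averaging_gibbs pi_cont pi0 piM pi1 t_gt0 tail kte). Qed.

Let avq s : 0 <= s <= t -> averaging (weight pi s) Lq.
Proof. exact: (averaging_gibbs pi_cont pi0 piM pi1 t_gt0 tail kte'). Qed.

(* An exponent strictly between 0 and [t], so that the law of large numbers of
   the upper level applies to functions dominated by the weight, in particular
   to bounded ones. *)
Let s0 := t / 2.
Let s0t : 0 <= s0 <= t. Proof. by rewrite /s0; move: t_gt0; lra. Qed.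
Let v0 := M `^ (- s0).
Let v0_gt0 : 0 < v0. Proof. by rewrite powR_gt0. Qed.
Let v0V x : v0 <= weight pi s0 x.
Proof. by apply: weight_lower => //; case/andP: s0t. Qed.

Definition bounded_cont (f : borel X -> R) :=
  continuous (f : X -> R) /\ exists c, forall x, `|f x| <= c.

Lemma bounded_cont_meas f : bounded_cont f -> bounded_meas f.
Proof. by move=> [cf bf]; split=> //; exact: continuous_borel_measurable. Qed.

(** One move of the lower level if the upper level had reached equilibrium. *)
Definition limit_op : (borel X -> R) -> borel X -> R := swap_op u P acc Lq.

(* The Hoelder exponent, small enough for the constant [pi y `^ (- (b * r))] to be
   dominated by the weight of exponent [s0]. *)
Let r := Num.min 1 (s0 / b).

Let r01 : 0 < r <= 1.
Proof.
rewrite /r lt_min ltr01 ge_min lexx/= andbT divr_gt0// /s0 divr_gt0//.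
Qed.

Let br : b * r <= s0.
Proof.
rewrite /r mulrC; apply: (@le_trans _ _ (s0 / b * b)).
  by rewrite ler_wpM2r ?(ltW b_gt0)// ge_min lexx orbT.
by rewrite divfK// gt_eqF.
Qed.

Let dom_weight s s' : s' <= s -> dominated (weight pi s) (weight pi s').
Proof.
move=> ss; split; first exact: measurable_weight.
exists (M `^ (s - s')) => x; rewrite ger0_norm ?weight_ge0//.
exact: weight_le.
Qed.

(** With [pi `^ e = pi `^ e' * pi `^ b], both sides are the product of the
    [e]-th powers of [pi] at [x] and [y] over a common factor. *)
Lemma gibbs_detailed_balance (x y : borel X) :
  gibbs mu pi e x * gibbs mu pi e' y * acc x y =
  gibbs mu pi e y * gibbs mu pi e' x * acc y x.
Proof.
have E z : pi z `^ e = pi z `^ e' * pi z `^ b.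
  by rewrite -powRD /b ?(gt_eqF (pi0 z)) ?implybT//; congr (_ `^ _); ring.
rewrite /gibbs /acc /accept /accept_at !E maxC.
ring.
Qed.

Let sf : sigma_finite setT mu.
Proof.
apply: (@sigma_finite_of_density R _ (borel X) mu pi) => //.
  exact: continuous_borel_measurable.
by rewrite pi1 ltry.
Qed.

Let mp := measurable_gibbs mu pi_cont pi0 e.
Let mq := measurable_gibbs mu pi_cont pi0 e'.
Let p0 := gibbs_ge0 pi_cont pi0 piM pi1 t_gt0 tail kte.
Let q0 := gibbs_ge0 pi_cont pi0 piM pi1 t_gt0 tail kte'.
Let intq := gibbs_integrable pi_cont pi0 piM t_gt0 tail kte'.

Lemma bm_limit_op f : bounded_meas f -> bounded_meas (limit_op f).
Proof.
by move=> bf; apply: (bm_swap_op sf v0_gt0 v0V u acc01 macc mp mq p0 q0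
  gibbs_detailed_balance invP (avp s0t) (avq s0t) intq bf).
Qed.

Lemma limit_op_invariant f : bounded_meas f -> Lp (limit_op f) = Lp f.
Proof.
by move=> bf; apply: (swap_op_invariant sf v0_gt0 v0V u acc01 macc mp mq p0 q0
  gibbs_detailed_balance invP (avp s0t) (avq s0t) intq bf).
Qed.

Let dVr : dominated (weight pi s0) (fun y : borel X => pi y `^ (- (b * r))).
Proof. exact: dom_weight. Qed.

(** Continuity of the mean under [P] is the Feller property; the swap part
    depends on [x] through [f x] and, in a Hoelder way, through [pi x]. *)
Lemma bounded_cont_limit_op f : bounded_cont f -> bounded_cont (limit_op f).
Proof.
move=> bcf; have bf := bounded_cont_meas bcf.
have [cf [c fc]] := bcf; have [_ [c' hc']] := bm_limit_op bf.
split; last by exists c'.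
have -> : limit_op f = (fun x => (1 - u) * \int[P x]_y f y +
    u * (Lq (fun y => acc x y * f y) + (f x - f x * Lq (acc x)))).
  apply/funext => x.
  exact: (swap_op_split v0_gt0 v0V u P acc01 macc (avq s0t)).
have c1 : continuous (fun x : X => Lq (fun y => acc x y * f y)).
  exact: (continuous_averaging_accept pi_cont pi0 v0_gt0 v0V r01 dVr bf.1 fc
    (avq s0t)).
have c2 : continuous (fun x : X => Lq (acc x)).
  have m1 : measurable_fun setT (fun _ : borel X => 1 : R).
    exact: measurable_cst.
  have h1 (y : borel X) : `|(1 : R)| <= 1 by rewrite normr1.
  have := continuous_averaging_accept pi_cont pi0 v0_gt0 v0V r01 dVr m1 h1
    (avq s0t).
  rewrite (_ : (fun x : X => _) = (fun x : X => Lq (acc x)))//.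
  by apply/funext => x; congr Lq; apply/funext => y; rewrite mulr1.
have supf : (sup_norm f < +oo)%E.
  apply: (@le_lt_trans _ _ c%:E); last exact: ltry.
  by apply: ge_ereal_sup => _ [x _ <-]; rewrite lee_fin.
have [c3 _] := fellerP cf supf.
move=> x; apply: cvgD; apply: cvgMr; first exact: c3.
apply: cvgD; first exact: c1.
by apply: cvgB; [exact: cf|apply: cvgM; [exact: cf|exact: c2]].
Qed.

Lemma bounded_cont_iter N f : bounded_cont f ->
  bounded_cont (iter N limit_op f).
Proof. by move=> bcf; elim: N => //= N ih; exact: bounded_cont_limit_op. Qed.

(* The part of the acceptance probability that does not depend on the current
   state. *)
Let h (y : borel X) : R := pi y `^ b / M `^ b.

Let bm_h : bounded_meas h.
Proof.
split.
  by apply: measurable_funM => //; exact: measurable_pi_powR.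
exists 1 => y; have /andP[h0 h1] := accept_lower pi0 piM b_gt0 point y.
by rewrite ger0_norm// (le_trans h1)//; case/andP: (acc01 point y).
Qed.

Let Lq_h : 0 < Lq h <= 1.
Proof.
have avq' := avq s0t; apply/andP; split; last first.
  rewrite -(av_cst avq' 1); apply: (av_le avq'); try exact: (dom_bm v0_gt0 v0V).
    by apply: (dom_bm v0_gt0 v0V); exact: bm_cst.
  move=> y; have /andP[_ h1] := accept_lower pi0 piM b_gt0 point y.
  by rewrite (le_trans h1)//; case/andP: (acc01 point y).
have Zp := normaliser_gt0 pi_cont pi0 piM pi1 t_gt0 tail kte.
have Zq := normaliser_gt0 pi_cont pi0 piM pi1 t_gt0 tail kte'.
have ip : mu.-integrable setT (fun x : borel X => (pi x `^ e)%:E).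
  apply: (powR_integrable pi_cont pi0).
  by apply: (powR_tail_finite pi_cont pi0 piM) tail; move: kte t_gt0; lra.
rewrite /Lq (_ : (fun x => h x * _) = (fun x =>
    (M `^ b * \int[mu]_y (pi y `^ e'))^-1 * pi x `^ e)).
  by rewrite RintegralZl// mulr_gt0// invr_gt0 mulr_gt0// powR_gt0.
apply/funext => x; rewrite /h /gibbs.
have -> : pi x `^ e = pi x `^ e' * pi x `^ b.
  by rewrite -powRD /b ?(gt_eqF (pi0 x)) ?implybT//; congr (_ `^ _); ring.
by rewrite invfM; ring.
Qed.

Definition contraction_rate : R := 1 - u * Lq h.

Lemma contraction_rate01 : 0 <= contraction_rate < 1.
Proof.
have /andP[l0 l1] := Lq_h; have /andP[u0 u1] := u01.
by rewrite /contraction_rate; apply/andP; split; nra.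
Qed.

Lemma iter_limit_op_osc N f c : bounded_cont f -> (forall x, `|f x| <= c) ->
  exists m m', (forall x, m <= iter N limit_op f x <= m') /\
    m' - m = contraction_rate ^+ N * (2 * c).
Proof.
move=> bcf fc; elim: N => [|N [m [m' [hm em]]]].
  exists (- c), c; split; last by rewrite expr0; ring.
  by move=> x; rewrite -ler_norml.
have bfN := bounded_cont_meas (bounded_cont_iter N bcf).
have [m1 [m1' [h1 e1]]] := swap_op_contract v0_gt0 v0V P u01 acc01 macc (avq s0t)
  bfN bm_h hm (fun x y => accept_lower pi0 piM b_gt0 x y).
exists m1, m1'; split => //.
by rewrite e1 em exprS -/contraction_rate mulrA.
Qed.

(** By invariance [Lp f] is also the mean of the [N]-th iterate, hence lies
    between its bounds. *)
Lemma iter_limit_op_close N f c x : bounded_cont f -> (forall x, `|f x| <= c) ->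
  `|iter N limit_op f x - Lp f| <= contraction_rate ^+ N * (2 * c).
Proof.
move=> bcf fc; have [m [m' [hm <-]]] := iter_limit_op_osc N bcf fc.
have bm_it n := bounded_cont_meas (bounded_cont_iter n bcf).
have <- : Lp (iter N limit_op f) = Lp f.
  by elim: N {hm} => //= N ih; rewrite limit_op_invariant.
have dc c' : dominated (weight pi s0) (fun=> c').
  by apply: (dom_bm v0_gt0 v0V); exact: bm_cst.
have dN : dominated (weight pi s0) (iter N limit_op f).
  exact: (dom_bm v0_gt0 v0V).
have l1 : m <= Lp (iter N limit_op f).
  rewrite -(av_cst (avp s0t) m); apply: (av_le (avp s0t)) => // z.
  by case/andP: (hm z).
have l2 : Lp (iter N limit_op f) <= m'.
  rewrite -(av_cst (avp s0t) m'); apply: (av_le (avp s0t)) => // z.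
  by case/andP: (hm z).
have /andP[? ?] := hm x.
by rewrite ler_norml; apply/andP; split; lra.
Qed.

(** A finite sum of iterates solves the Poisson equation up to the remainder
    [iter N limit_op f], which is uniformly close to a constant; no infinite
    series of iterates has to be shown continuous. *)
Definition poisson_sum N f (x : borel X) : R :=
  \sum_(0 <= i < N) iter i limit_op f x.

Lemma bounded_cont_poisson_sum N f : bounded_cont f ->
  bounded_cont (poisson_sum N f).
Proof.
move=> bcf; rewrite /poisson_sum; elim: N => [|N [ch [c hc]]].
  split; last by exists 0 => x; rewrite big_geq ?normr0.
  by under eq_fun do rewrite big_geq//; exact: cst_continuous.
have [cN [c' hc']] := bounded_cont_iter N bcf; split.
  under eq_fun do rewrite big_nat_recr//=.
  by move=> x; apply: cvgD; [exact: ch|exact: cN].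
exists (c + c') => x; rewrite big_nat_recr//=.
by rewrite (le_trans (ler_normD _ _))// lerD.
Qed.

Lemma poisson_equation N f x : bounded_cont f ->
  poisson_sum N f x - limit_op (poisson_sum N f) x = f x - iter N limit_op f x.
Proof.
move=> bcf; elim: N => [|N ih].
  have -> : poisson_sum 0 f = fun=> 0.
    by apply/funext => z; rewrite /poisson_sum big_geq.
  by rewrite /limit_op (swap_op_cst u P acc (avq s0t)) !subrr.
have -> : poisson_sum N.+1 f = fun z => poisson_sum N f z + iter N limit_op f z.
  by apply/funext => z; rewrite /poisson_sum big_nat_recr.
rewrite {2}/limit_op (swap_opD v0_gt0 v0V u P acc01 macc (avq s0t)).
- by rewrite -/limit_op /= -[iter N _ f x](addrK (limit_op (iter N limit_op f) x));
    move: ih; lra.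
- exact: bounded_cont_meas (bounded_cont_poisson_sum N bcf).
- exact: bounded_cont_meas (bounded_cont_iter N bcf).
Qed.

(** A swap moves to the proposal or stays, so it adds at most the empirical mean
    of the weight; the contraction of [P] survives with the factor
    [(1 - u) * lam + u < 1]. *)
Lemma estep_drift s : 0 < s < e -> exists lam c : R, [/\ 0 <= lam < 1, 0 <= c &
  forall n y x, (estep u P acc n y x (EFin \o weight pi s) <=
    (lam * weight pi s x + c + empirical n y (weight pi s))%:E)%E].
Proof.
move=> se; have [lam [c [/andP[l0 l1] hP]]] := driftP se.
have /andP[u0 u1] := u01; have u1' : 0 < 1 - u by rewrite subr_gt0.
exists ((1 - u) * lam + u), `|c|; split => //.
  have h1 : 0 < (1 - u) * (1 - lam) by rewrite mulr_gt0 ?subr_gt0.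
  have h2 : 0 < (1 - u) * lam by rewrite mulr_gt0.
  by apply/andP; split; lra.
move=> n y x; set W := weight pi s.
have W0 z : 0 <= W z by exact: weight_ge0.
have h1 : ((1 - u)%:E * \int[P x]_z (W z)%:E <=
    ((1 - u) * (lam * W x + c))%:E)%E.
  by rewrite EFinM; apply: lee_wpmul2l; [rewrite lee_fin ltW|exact: hP].
apply: (le_trans (leeD h1 (lexx _))).
have -> : (\sum_(0 <= l < n.+1) ((acc x (y l))%:E * (EFin \o W) (y l) +
   (1 - acc x (y l))%:E * (EFin \o W) x))%E =
   (\sum_(0 <= l < n.+1) (acc x (y l) * W (y l) + (1 - acc x (y l)) * W x))%:E.
  by rewrite -sumEFin; apply: eq_bigr => l _.
rewrite -!EFinM -EFinD lee_fin.
have h2 : empirical n y (fun z => acc x z * W z + (1 - acc x z) * W x) <=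
    empirical n y (fun z => W z + W x).
  apply: le_empirical => z; have /andP[a0 a1] := acc01 x z.
  have k1 : 0 <= (1 - acc x z) * W z by rewrite mulr_ge0// subr_ge0.
  have k2 : 0 <= acc x z * W x by rewrite mulr_ge0.
  lra.
move: h2; rewrite empiricalD empirical_cst /empirical.
set A := n.+1%:R^-1 * _; set B := n.+1%:R^-1 * _ => h2.
have B0 : 0 <= B by rewrite mulr_ge0 ?invr_ge0// sumr_ge0.
have cn := ler_norm c; have c0 := normr_ge0 c.
have h3 : u * A <= u * (B + W x) by rewrite ler_wpM2l// ltW.
have h4 : u * B <= B by rewrite ler_piMl// ltW.
have h5 : (1 - u) * c <= `|c|.
  apply: (@le_trans _ _ ((1 - u) * `|c|)); first by rewrite ler_wpM2l// ltW.
  by rewrite ler_piMl//; lra.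
lra.
Qed.

Section process.
Context (d : measure_display) (Omega : measurableType d)
  (Pr : probability Omega R).
Variables (Xp Yp : nat -> Omega -> borel X) (G : nat -> set (set Omega)).
Hypothesis Gm : forall n B, <<s G n >> B -> measurable B.
Hypothesis Gmono : forall n B, <<s G n >> B -> <<s G n.+1 >> B.
Hypothesis mX : forall n l, (l <= n)%N ->
  measurable_fun setT (Xp l : g_sigma_algebraType (G n) -> borel X).
Hypothesis mY : forall n l, (l <= n)%N ->
  measurable_fun setT (Yp l : g_sigma_algebraType (G n) -> borel X).
Hypothesis step_law : forall n B A, <<s G n >> B -> measurable A ->
  Pr (B `&` Xp n.+1 @^-1` A) =
  (\int[Pr]_(w in B)
     estep u P acc n (Yp ^~ w) (Xp n w) (fun x => (\1_A x)%:E))%E.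
Hypothesis llnY : forall s (f : borel X -> R), 0 < s < t ->
  continuous (f : X -> R) -> (exists C, forall x, `|f x| <= C * weight pi s x) ->
  {ae Pr, forall w, empirical n (Yp ^~ w) f @[n --> \oo] --> Lq f}.
Hypothesis momY : exists C : R, forall n,
  (\int[Pr]_w (weight pi t (Yp n w))%:E <= C%:E)%E.
Hypothesis momX0 : (\int[Pr]_w (weight pi t (Xp 0%N w))%:E < +oo)%E.

Lemma lower_moments : exists C : R, forall n,
  (\int[Pr]_w (weight pi t (Xp n w))%:E <= C%:E)%E.
Proof.
have te : 0 < t < e by rewrite t_gt0 (lt_trans te').
have [lam [c [lam01 c0 hd]]] := estep_drift te.
have [CY hY] := momY.
apply: (@moments_bounded _ _ _ u P acc u01 acc01 macc _ _ Pr Xp Yp G Gm mX mY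
  step_law (weight pi t) lam c CY) => //.
- exact: measurable_weight.
- exact: weight_ge0.
Qed.

Lemma llnY_bounded f : bounded_cont f ->
  {ae Pr, forall w, empirical n (Yp ^~ w) f @[n --> \oo] --> Lq f}.
Proof.
move=> [cf [c fc]]; apply: (llnY (s := s0)) => //.
  by rewrite /s0; move: t_gt0; lra.
exists (c / v0) => x; have c0 : 0 <= c by exact: le_trans (fc x).
by rewrite (le_trans (fc x))// mulrAC ler_pdivlMr// ler_wpM2l.
Qed.

Let one := one_step u P acc Xp Yp.

(** The swap moves see the upper level only through its empirical measure,
    and the acceptance probability depends on the current state only through
    [pi]; hence the one-step mean is asymptotically [limit_op f], uniformly in
    the current state. *)
Lemma one_step_limit f : bounded_cont f ->
  {ae Pr, forall w, one n f w - limit_op f (Xp n w) @[n --> \oo] --> (0 : R)}.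
Proof.
move=> bcf; have bf := bounded_cont_meas bcf; have [cf [c fc]] := bcf.
have bc1 : bounded_cont (fun=> 1).
  by split; [exact: cst_continuous|exists 1 => x; rewrite normr1].
have b1 := bounded_cont_meas bc1.
have bcM (g : borel X -> R) (tau : R) : bounded_cont g ->
    bounded_cont (fun y => accept_at pi b tau y * g y).
  move=> [cg [c' gc']]; split.
    move=> y; apply: cvgM; last exact: cg.
    exact: (continuous_accept_at pi_cont pi0).
  exists c' => y; rewrite normrM -[leRHS]mul1r ler_pM//.
  have /andP[? ?] := accept_at01 b pi0 tau y.
  by rewrite ger0_norm.
have ae_mesh g : bounded_cont g -> {ae Pr, forall w, forall m i : nat,
    let tau := i.+1%:R * (M `^ b / m.+1%:R) in
    empirical n (Yp ^~ w) (fun y => accept_at pi b tau y * g y) @[n --> \oo]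
      --> Lq (fun y => accept_at pi b tau y * g y)}.
  move=> bcg; apply: ae_foralln => m; apply: ae_foralln => i.
  exact/llnY_bounded/bcM.
have ae_Vr : {ae Pr, forall w, empirical n (Yp ^~ w)
    (fun y => pi y `^ (- (b * r))) @[n --> \oo] -->
    Lq (fun y => pi y `^ (- (b * r)))}.
  apply: (llnY (s := s0)).
  - by rewrite /s0; move: t_gt0; lra.
  - exact: continuous_powR_comp.
  - exact: dVr.2.
near=> w.
have meshf : forall m i : nat, let tau := i.+1%:R * (M `^ b / m.+1%:R) in
    empirical n (Yp ^~ w) (fun y => accept_at pi b tau y * f y) @[n --> \oo]
      --> Lq (fun y => accept_at pi b tau y * f y).
  by near: w; exact: ae_mesh.
have mesh1 : forall m i : nat, let tau := i.+1%:R * (M `^ b / m.+1%:R) in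
    empirical n (Yp ^~ w) (fun y => accept_at pi b tau y * 1) @[n --> \oo]
      --> Lq (fun y => accept_at pi b tau y * 1).
  by near: w; exact: ae_mesh.
have cVr : empirical n (Yp ^~ w) (fun y => pi y `^ (- (b * r))) @[n --> \oo] -->
    Lq (fun y => pi y `^ (- (b * r))) by near: w.
have [B hB] := cvg_ubound cVr.
have avn n := averaging_empirical (weight pi s0) n (Yp ^~ w).
have h1 (y : borel X) : `|(1 : R)| <= 1 by rewrite normr1.
have uf := uniform_averaging_accept pi_cont pi0 piM b_gt0 v0_gt0 v0V r01 dVr
  bf.1 fc avn (avq s0t) hB meshf.
have u1 := uniform_averaging_accept pi_cont pi0 piM b_gt0 v0_gt0 v0V r01 dVr
  b1.1 h1 avn (avq s0t) hB mesh1.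
have c0 : 0 <= c by exact: le_trans (fc point).
apply/cvgrPdist_le => eps eps0.
have e0 : 0 < eps / (1 + c) by rewrite divr_gt0// ltr_wpDr.
apply: filterS2 (uf _ e0) (u1 _ e0) => n.
set x := Xp n w => /(_ x) hf /(_ x) hone; rewrite sub0r normrN.
have -> : one n f w - limit_op f x =
  u * ((empirical n (Yp ^~ w) (fun y => acc x y * f y) -
        Lq (fun y => acc x y * f y)) -
       f x * (empirical n (Yp ^~ w) (fun y => acc x y * 1) -
              Lq (fun y => acc x y * 1))).
  rewrite /one /one_step /limit_op.
  rewrite (swap_op_split v0_gt0 v0V u P acc01 macc (avn n))//.
  rewrite (swap_op_split v0_gt0 v0V u P acc01 macc (avq s0t))//.
  have -> : (fun y => acc x y * 1) = acc x.
    by apply/funext => y; rewrite mulr1.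
  by rewrite -/x; ring.
have /andP[u0 u1'] := u01.
rewrite normrM (gtr0_norm u0).
apply: (@le_trans _ _ (eps / (1 + c) + c * (eps / (1 + c)))).
  rewrite -[leRHS]mul1r ler_pM ?(ltW u0) ?(ltW u1')//.
  apply: (le_trans (ler_normB _ _)); rewrite lerD// normrM.
  by rewrite ler_pM.
rewrite -{1}[eps / (1 + c)]mul1r -mulrDl mulrC divfK// gt_eqF//.
by rewrite ltr_wpDr.
Unshelve. all: by end_near. Qed.

(** The averages of [f] differ from those of its [N]-th iterate by averages that
    vanish by the Poisson equation, and the iterate is within
    [contraction_rate ^+ N * (2 * c)] of [Lp f]. *)
Lemma lln_bounded_cont f : bounded_cont f ->
  {ae Pr, forall w, empirical n (Xp ^~ w) f @[n --> \oo] --> Lp f}.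
Proof.
move=> bcf; have [cf [c fc]] := bcf.
have bcF N := bounded_cont_poisson_sum N bcf.
have ae_mart : {ae Pr, forall w, forall N,
    n%:R^-1 * mart_sum u P acc Xp Yp (poisson_sum N f) n w
      @[n --> \oo] --> (0 : R)}.
  apply: ae_foralln => N.
  have bF := bounded_cont_meas (bcF N).
  exact: (@mart_sum_lln _ _ _ u P acc u01 acc01 macc _ _ Pr Xp Yp G Gm Gmono mX
    mY step_law _ bF).
have ae_one : {ae Pr, forall w, forall N,
    one n (poisson_sum N f) w - limit_op (poisson_sum N f) (Xp n w)
      @[n --> \oo] --> (0 : R)}.
  by apply: ae_foralln => N; exact: one_step_limit.
apply: filterS2 ae_mart ae_one => w hmart hone.
have c0 : 0 <= c by exact: le_trans (fc point).
have rate := contraction_rate01.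
have cvg_rate : contraction_rate ^+ N * (2 * c) @[N --> \oo] --> (0 : R).
  rewrite -[X in _ --> X](mul0r (2 * c)); apply: cvgMl.
  by apply: cvg_expr; case/andP: rate => ? ?; rewrite ger0_norm.
apply/cvgrPdist_le => eps eps0.
have e2 : 0 < eps / 2 by rewrite divr_gt0.
move/cvgrPdist_le : cvg_rate => /(_ _ e2)[N _ /(_ N (leqnn N))].
rewrite /= sub0r normrN => hN.
have {}hN := le_trans (ler_norm _) hN.
have [_ [cF hF]] := bcF N.
have := poisson_path hF (hmart N) (hone N).
move/cvgrPdist_le => /(_ _ e2); apply: filterS => n; rewrite sub0r normrN.
have -> : (fun z => poisson_sum N f z - limit_op (poisson_sum N f) z) =
    (fun z => f z - iter N limit_op f z).
  by apply/funext => z; exact: poisson_equation.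
rewrite empiricalB => h1.
have h2 : `|empirical n (Xp ^~ w) (iter N limit_op f) - Lp f| <= eps / 2.
  have hx z : - (eps / 2) + Lp f <= iter N limit_op f z <= eps / 2 + Lp f.
    have := le_trans (iter_limit_op_close N z bcf fc) hN.
    by rewrite ler_norml => /andP[? ?]; apply/andP; split; lra.
  rewrite ler_norml lerBrDr lerBlDr; apply/andP; split.
    rewrite -[leLHS](empirical_cst n (Xp ^~ w)).
    by apply: le_empirical => z; case/andP: (hx z).
  rewrite -[leRHS](empirical_cst n (Xp ^~ w)).
  by apply: le_empirical => z; case/andP: (hx z).
move: h1 h2; rewrite !ler_norml => /andP[? ?] /andP[? ?].
by apply/andP; split; lra.
Qed.

(** [weight pi s'] is the power [s' / t] of [weight pi t], whose moments are
    bounded, and [s' > t / 2] keeps the inverse of this power at most 2. The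
    empirical means of the weight at the upper level converge, hence enter the
    drift inequality as a finite random constant. *)
Lemma weight_average_bounded s' : t / 2 < s' < t ->
  {ae Pr, forall w, exists B, forall n,
    empirical n (Xp ^~ w) (weight pi s') <= B}.
Proof.
move=> /andP[ts s't].
have s'0 : 0 < s' by apply: lt_trans ts; rewrite divr_gt0.
have [C hC] := lower_moments.
have s'e : 0 < s' < e by rewrite s'0 (lt_trans s't)// (lt_trans te').
have [lam [c [lam01 c0 hd]]] := estep_drift s'e.
have Wp : (fun z => weight pi t z `^ (t / s')^-1) = weight pi s'.
  apply/funext => z; rewrite /weight -powRrM invf_div mulrC.
  by congr (_ `^ _); field; rewrite gt_eqF.
rewrite -Wp.
apply: (@average_bounded _ _ _ u P acc u01 acc01 macc _ _ Pr Xp Yp G Gm Gmono mX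
  mY step_law (weight pi t) (t / s') C lam) => //.
- exact: measurable_weight.
- exact: weight_ge0.
- rewrite ltr_pdivlMr// mul1r s't/= ler_pdivrMr//; move: ts; lra.
have aeY : {ae Pr, forall w, empirical n (Yp ^~ w) (weight pi s') @[n --> \oo] -->
    Lq (weight pi s')}.
  apply: (llnY (s := s')); first by rewrite s'0.
    exact: continuous_powR_comp.
  by exists 1 => x; rewrite mul1r ger0_norm// weight_ge0.
apply: filterS aeY => w /cvg_ubound[B hB].
exists (c + B) => n k k0.
have mW := measurable_weight pi_cont pi0 s'.
have e1 z : weight pi t z `^ (t / s')^-1 = weight pi s' z.
  by have := congr1 (fun F => F z) Wp.
have bmin : bounded_meas (fun z => Num.min (weight pi t z `^ (t / s')^-1) k).
  under eq_fun do rewrite e1; split.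
    by apply: measurable_minr.
  exists k => z; rewrite ger0_norm ?ge_min ?lexx ?orbT//.
  by rewrite le_min k0 weight_ge0.
rewrite -lee_fin /one_step -estep_real//.
apply: (@le_trans _ _ (estep u P acc n (Yp ^~ w) (Xp n w)
    (EFin \o weight pi s'))).
  apply: (il_le (integral_like_estep P u01 acc01 n _ _)).
  - split; first by apply/measurable_EFinP; exact: bmin.1.
    by move=> z /=; rewrite lee_fin le_min k0 powR_ge0.
  - split; first exact/measurable_EFinP.
    by move=> z /=; rewrite lee_fin weight_ge0.
  - by move=> z /=; rewrite lee_fin e1 ge_min lexx.
apply: (le_trans (hd n (Yp ^~ w) (Xp n w))).
by rewrite lee_fin e1 -addrA lerD2l lerD2l.
Qed.

(** Where [weight pi (s' - s)] exceeds [C / eps] the larger weight wins;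
    elsewhere the smaller one is bounded. *)
Lemma weight_absorb s s' C eps : 0 < s -> s < s' -> 0 <= C -> 0 < eps ->
  exists2 K, 0 <= K & forall x, C * weight pi s x <= eps * weight pi s' x + K.
Proof.
move=> s_gt0 ss' C0 eps0; have d0 : 0 < s' - s by rewrite subr_gt0.
pose z0 := C / eps; have z00 : 0 <= z0 by rewrite divr_ge0// ltW.
exists (C * z0 `^ (s / (s' - s))); first by rewrite mulr_ge0 ?powR_ge0.
move=> x; pose z := weight pi (s' - s) x.
have z_ge0 : 0 <= z by exact: weight_ge0.
have zs : weight pi s x = z `^ (s / (s' - s)).
  rewrite /z /weight -powRrM; congr (_ `^ _).
  by field; rewrite gt_eqF.
have zs' : weight pi s' x = z * weight pi s x.
  rewrite /z /weight -powRD ?(gt_eqF (pi0 x)) ?implybT//.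
  by congr (_ `^ _); ring.
have w_ge0 := weight_ge0 pi s x.
have [h1|h1] := leP z0 z.
  have : C * weight pi s x <= eps * weight pi s' x.
    rewrite zs' mulrA ler_wpM2r//.
    by rewrite mulrC -ler_pdivrMr.
  have : 0 <= C * z0 `^ (s / (s' - s)) by rewrite mulr_ge0 ?powR_ge0.
  lra.
have : C * weight pi s x <= C * z0 `^ (s / (s' - s)).
  rewrite ler_wpM2l// zs; apply: ge0_ler_powR; rewrite ?nnegrE//.
    by rewrite divr_ge0// ltW.
  exact: ltW.
have : 0 <= eps * weight pi s' x by rewrite mulr_ge0 ?weight_ge0// ltW.
lra.
Qed.

(** Truncating [f] at height [K j] changes it by at most [eps_ j] times the weight
    of an exponent [s'] between [s] and [t]; the averages of that weight stay
    bounded, so the error is uniform in time. *)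
Lemma lln_weighted s (f : borel X -> R) : 0 < s < t ->
  continuous (f : X -> R) -> (exists C, forall x, `|f x| <= C * weight pi s x) ->
  {ae Pr, forall w, empirical n (Xp ^~ w) f @[n --> \oo] --> Lp f}.
Proof.
move=> /andP[s_gt0 st] cf [C fC].
pose s' := (Num.max s (t / 2) + t) / 2.
have th : t / 2 < t by move: t_gt0; lra.
have ms : Num.max s (t / 2) < t by rewrite gt_max st.
have s_max : s <= Num.max s (t / 2) by rewrite le_max lexx.
have t_max : t / 2 <= Num.max s (t / 2) by rewrite le_max lexx orbT.
have ss' : s < s' by rewrite /s'; lra.
have ts' : t / 2 < s' < t by rewrite /s'; apply/andP; split; lra.
have /andP[_ s't] := ts'.
have s'0t : 0 <= s' <= t by rewrite !ltW// (lt_trans s_gt0).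
have C0 : 0 <= C.
  have := le_trans (normr_ge0 _) (fC point).
  by rewrite pmulr_lge0// powR_gt0.
pose eps_ j : R := j.+1%:R^-1.
have eps_gt0 j : 0 < eps_ j by rewrite invr_gt0.
have /choice[K hK] j : exists K, 0 <= K /\
    forall x, C * weight pi s x <= eps_ j * weight pi s' x + K.
  have [K K0 hK] := weight_absorb s_gt0 ss' C0 (eps_gt0 j).
  by exists K.
pose f_ j (x : borel X) := Num.max (- K j) (Num.min (f x) (K j)).
have f_bound j x : `|f_ j x| <= K j.
  have [k0 _] := hK j; rewrite ler_norml /f_ le_max lexx/= ge_max.
  by rewrite ge_min lexx orbT andbT; lra.
have f_close j x : `|f x - f_ j x| <= eps_ j * weight pi s' x.
  have [k0 kx] := hK j.
  have h0 : 0 <= eps_ j * weight pi s' x.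
    by rewrite mulr_ge0 ?weight_ge0// ltW.
  have := le_trans (fC x) (kx x); rewrite ler_norml => /andP[? ?].
  rewrite ler_norml /f_ maxEle minEle; case: (leP (f x) (K j)) => ?;
    [case: (leP (- K j) (f x)) => ?|case: (leP (- K j) (K j)) => ?];
    by apply/andP; split; lra.
have f_cont j : bounded_cont (f_ j).
  split; last by exists (K j).
  move=> x; apply: (@continuous_max R X (fun=> - K j)
    (fun x => Num.min (f x) (K j)) x).
    exact: cvg_cst.
  apply: (@continuous_min R X f (fun=> K j) x); first exact: cf.
  exact: cvg_cst.
have ae_j : {ae Pr, forall w, forall j,
    empirical n (Xp ^~ w) (f_ j) @[n --> \oo] --> Lp (f_ j)}.
  by apply: ae_foralln => j; exact: lln_bounded_cont.
apply: filterS2 ae_j (weight_average_bounded ts') => w hj [B hB].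
have av := avp s'0t.
have dW : dominated (weight pi s') (weight pi s') by exact: dom_weight.
have vl x : M `^ (- s') <= weight pi s' x.
  by apply: weight_lower => //; case/andP: s'0t.
have v_gt0 : 0 < M `^ (- s') by rewrite powR_gt0.
have df : dominated (weight pi s') f.
  split; first exact: continuous_borel_measurable.
  exists (C * M `^ (s' - s)) => x; rewrite (le_trans (fC x))// -mulrA.
  by rewrite ler_wpM2l// weight_le// ltW.
have dfj j : dominated (weight pi s') (f_ j).
  by apply: (dom_bm v_gt0 vl); exact: bounded_cont_meas.
pose D := B + Lp (weight pi s').
have close th' j : averaging (weight pi s') th' ->
    `|th' f - th' (f_ j)| <= eps_ j * th' (weight pi s').
  move=> avt; rewrite -(avB avt)// -(avZ avt)//.
  apply: (av_norm_le avt) => //; [exact: domB|exact: domZ].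
have W_ge0 th' : averaging (weight pi s') th' -> 0 <= th' (weight pi s').
  move=> avt; rewrite -(av_cst avt 0); apply: (av_le avt) => //.
    by apply: (dom_bm v_gt0 vl); exact: bm_cst.
  by move=> x; exact: weight_ge0.
have avn n := averaging_empirical (weight pi s') n (Xp ^~ w).
have D0 : 0 <= D.
  have B0 : 0 <= B := le_trans (W_ge0 _ (avn 0%N)) (hB 0%N).
  exact: addr_ge0 B0 (W_ge0 _ av).
apply/cvgrPdist_le => eps eps0.
have e2 : 0 < eps / 2 by rewrite divr_gt0.
have cvg_eps : eps_ j * D @[j --> \oo] --> (0 : R).
  by rewrite -[X in _ --> X](mul0r D); apply: cvgMl; exact: cvg_harmonic.
move/cvgrPdist_le : cvg_eps => /(_ _ e2)[j _ /(_ j (leqnn j))].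
rewrite /= sub0r normrN => /(le_trans (ler_norm _)) hjD.
have /cvgrPdist_le/(_ _ e2) := hj j; apply: filterS => n h1.
have h2 := close _ j av; have h3 := close _ j (avn n).
have h4 : eps_ j * empirical n (Xp ^~ w) (weight pi s') <= eps_ j * B.
  by rewrite ler_wpM2l// ltW.
move: hjD; rewrite /D mulrDr => hjD.
have {}h3 := le_trans h3 h4.
move: h1 h2 h3; rewrite !ler_norml => /andP[? ?] /andP[? ?] /andP[? ?].
by apply/andP; split; lra.
Qed.

End process.

End level.

(** * Descent through the levels *)

Section averages.
Variable R : realType.

(** The first term contributes [O (n ^- 1)], and the ratio of the normalisations
    tends to 1. *)
Lemma cvg_empirical d (T : measurableType d) (y : nat -> T) (f : T -> R)
    (l : R) :
  n%:R^-1 * (\sum_(1 <= k < n.+1) f (y k)) @[n --> \oo] --> l <->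
  empirical n y f @[n --> \oo] --> l.
Proof.
pose S n := \sum_(1 <= k < n.+1) f (y k).
have empE n : empirical n y f = n.+1%:R^-1 * (f (y 0%N) + S n).
  by rewrite /empirical big_nat_recl// /S big_add1.
have S0 : S 0%N = 0 by rewrite /S big_geq.
have h0 c : n.+1%:R^-1 * c @[n --> \oo] --> (0 : R).
  by rewrite -[X in _ --> X](mul0r c); apply: cvgMl; exact: cvg_harmonic.
have inv0 : n%:R^-1 @[n --> \oo] --> (0 : R).
  by rewrite -(cvg_shiftS (fun n : nat => n%:R^-1 : R)); exact: cvg_harmonic.
split => h.
  have -> : (fun n => empirical n y f) = (fun n => n.+1%:R^-1 * f (y 0%N) +
      n%:R^-1 * S n * (1 - n.+1%:R^-1)).
    apply/funext => -[|n]; rewrite empE; first by rewrite S0; ring.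
    by field; rewrite -natrD nat1r !pnatr_eq0.
  rewrite -[l]add0r -[l in _ + l]mulr1; apply: cvgD; first exact: h0.
  apply: cvgM => //; rewrite -[X in _ --> X]subr0; apply: cvgB.
    exact: cvg_cst.
  exact: cvg_harmonic.
have -> : (fun n => n%:R^-1 * \sum_(1 <= k < n.+1) f (y k)) =
    (fun n => (empirical n y f - n.+1%:R^-1 * f (y 0%N)) * (1 + n%:R^-1)).
  apply/funext => -[|n]; rewrite empE -/(S _); first by rewrite S0; ring.
  by field; rewrite -natrD nat1r !pnatr_eq0.
rewrite -[l]mulr1 -[l in l * _]subr0 -[X in _ * X]addr0.
apply: cvgM; first by apply: cvgB => //; exact: h0.
by apply: cvgD => //; exact: cvg_cst.
Qed.

End averages.

Section tempering_identification.
Context (R : realType) (X : ptopologicalType).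

Lemma swap_acceptanceE (pi : X -> R) (Temp : nat -> R) k (x z : borel X) :
  (forall x, 0 < pi x) ->
  swap_acceptance (T := borel X) pi Temp k x z =
  accept pi ((Temp k)^-1 - (Temp k.+1)^-1) x z.
Proof.
move=> pi0; rewrite /swap_acceptance /accept /accept_at.
set c := (Temp k)^-1 - _.
have -> : (Temp k.+1)^-1 - (Temp k)^-1 = - c by rewrite /c opprB.
have a0 : 0 < pi x `^ c by rewrite powR_gt0.
have b0 : 0 < pi z `^ c by rewrite powR_gt0.
have -> : (pi x / pi z) `^ (- c) = pi z `^ c / pi x `^ c.
  rewrite powRN powRM ?invr_ge0 ?ltW// invfM mulrC; congr (_ * _).
  by rewrite -powR_inv1 ?ltW// -powRrM mulN1r powRN invrK.
set A := pi x `^ c in a0 *; set B := pi z `^ c in b0 *.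
rewrite minEle maxEle ler_pdivlMr// mul1r.
by case: leP => // _; rewrite mulfV// gt_eqF.
Qed.

Lemma tempering_stepE (upsilon : R) (P : nat -> R.-pker borel X ~> borel X)
    (pi : X -> R) (Temp : nat -> R) k n past (x : borel X) A :
  (forall x, 0 < pi x) -> measurable A ->
  tempering_step (T := borel X) upsilon P pi Temp k n past x A =
  estep upsilon (P k) (accept pi ((Temp k)^-1 - (Temp k.+1)^-1)) n past x
    (fun z => (\1_A z)%:E).
Proof.
move=> pi0 mA; rewrite /tempering_step /estep integral_indic// setIT.
congr (_ + _ * (_ * _))%E; apply: eq_bigr => l _.
by rewrite !swap_acceptanceE// !diracE !indicE.
Qed.

End tempering_identification.

Section levels.
Context (R : realType) (X : ptopologicalType).
Variables (mu : {measure set (borel X) -> \bar R}) (pi : X -> R)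
  (K : nat) (Temp : nat -> R) (Ttilde upsilon : R)
  (P : nat -> R.-pker borel X ~> borel X)
  (d : measure_display) (Omega : measurableType d)
  (Pr : probability Omega R) (Z : nat -> nat -> {RV Pr >-> borel X}).
Hypotheses (pi_density : density mu pi) (pi_cont : continuous pi)
  (pi0 : forall x, 0 < pi x).
Variable M : R.
Hypothesis piM : forall x, pi x <= M.
Hypothesis Temp1 : Temp 1%N = 1.
Hypothesis Temp_increasing : forall i, (1 <= i < K)%N -> Temp i < Temp i.+1.
Hypothesis P_feller : forall i, (1 <= i < K)%N -> feller (P i).
Hypothesis P_invariant : forall i, (1 <= i < K)%N ->
  invariant_density mu (tempered mu pi (Temp i)) (P i).
Hypothesis P_drift : forall i, (1 <= i < K)%N ->
  forall s : R, 0 < s < (Temp i)^-1 ->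
    exists2 c : R, 0 < c & drift_condition (P i) (fun x => c * pi x `^ (- s)).
Hypothesis upsilon01 : 0 < upsilon < 1.
Hypothesis Z_tempering : interacting_tempering upsilon P pi Temp K Z.
Hypothesis TempK : Temp K < Ttilde.
Hypothesis tail :
  (\int[mu]_x (pi x `^ ((Temp K)^-1 - Ttilde^-1))%:E < +oo)%E.
Hypothesis Z0_moment : forall i, (1 <= i < K)%N ->
  (\int[Pr]_w (weight pi Ttilde^-1 (Z i 0%N w))%:E < +oo)%E.

Definition level_moments k := exists C : R, forall n,
  (\int[Pr]_w (weight pi Ttilde^-1 (Z k n w))%:E <= C%:E)%E.

(** All exponents below [Ttilde^-1] are allowed at every level: the proof of
    [lln_weighted] for [s] uses the upper level only at exponents between [s]
    and [Ttilde^-1] or at [Ttilde^-1 / 2], so nothing is lost from one level to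
    the next. *)
Definition level_lln k := forall s (f : borel X -> R), 0 < s < Ttilde^-1 ->
  continuous (f : X -> R) -> (exists C, forall x, `|f x| <= C * weight pi s x) ->
  {ae Pr, forall w, empirical n (Z k ^~ w) f @[n --> \oo] -->
    \int[mu]_x (f x * gibbs mu pi (Temp k)^-1 x)}.

Lemma Temp_bounds i : (1 <= i <= K)%N -> 1 <= Temp i <= Temp K.
Proof.
move=> /andP[i1 iK].
have mono a b : (1 <= a)%N -> (a + b <= K)%N -> Temp a <= Temp (a + b).
  move=> a1; elim: b => [|b ih]; first by rewrite addn0.
  rewrite addnS => abK; apply: (le_trans (ih (ltnW abK))).
  by apply/ltW/Temp_increasing; rewrite abK (leq_trans a1)// leq_addr.
apply/andP; split.
  by rewrite -Temp1; have := mono 1%N i.-1 isT; rewrite add1n prednK//; exact.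
by have := mono i (K - i)%N i1; rewrite subnKC//; exact.
Qed.

(** The filtration is the history of the levels [k] and [k.+1], to which both
    processes are adapted, and the exponents are the inverse temperatures. *)
Lemma level_step k : (1 <= k < K)%N -> level_moments k.+1 -> level_lln k.+1 ->
  level_moments k /\ level_lln k.
Proof.
move=> kK momY llnY; have /andP[k1 ltkK] := kK.
have /andP[Tk1 TkK] : 1 <= Temp k <= Temp K.
  by apply: Temp_bounds; rewrite k1 ltnW.
have /andP[Tk1' TkK'] : 1 <= Temp k.+1 <= Temp K by apply: Temp_bounds.
have TK : Temp k < Temp k.+1 by exact: Temp_increasing.
have T0 : 0 < Temp k by lra.
have T0' : 0 < Temp k.+1 by lra.
have TK0 : 0 < Temp K by lra.
have Tt0 : 0 < Ttilde by exact: lt_trans TK0 TempK.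
have t_gt0 : 0 < Ttilde^-1 by rewrite invr_gt0.
have tK : Ttilde^-1 < (Temp K)^-1 by rewrite ltf_pV2.
have Ke' : (Temp K)^-1 <= (Temp k.+1)^-1 by rewrite lef_pV2.
have e'e : (Temp k.+1)^-1 < (Temp k)^-1 by rewrite ltf_pV2.
have te' : Ttilde^-1 < (Temp k.+1)^-1 by exact: lt_le_trans Ke'.
have kte' : (Temp K)^-1 - Ttilde^-1 + Ttilde^-1 <= (Temp k.+1)^-1 by rewrite subrK.
have [_ _ pi1] := pi_density.
pose G n : set (set Omega) := [set B | exists j l : nat, exists A : set (borel X),
   [/\ (k <= j <= k.+1)%N, (l <= n)%N, measurable A & B = Z j l @^-1` A]].
have Gm n B : <<s G n >> B -> measurable B.
  apply: smallest_sub; first exact: sigma_algebra_measurable.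
  move=> _ [j [l [A [_ _ mA ->]]]].
  by rewrite -[_ @^-1` _]setTI; exact: measurable_funP.
have Gmono n B : <<s G n >> B -> <<s G n.+1 >> B.
  apply: sub_smallest2r; first exact: smallest_sigma_algebra.
  move=> _ [j [l [A [jk ln mA ->]]]]; exists j, l, A; split => //.
  exact: leqW.
have mZ j n l : (k <= j <= k.+1)%N -> (l <= n)%N ->
    measurable_fun setT (Z j l : g_sigma_algebraType (G n) -> borel X).
  move=> jk ln _ A mA; rewrite setTI; apply: sub_sigma_algebra.
  by exists j, l, A.
have mX n l : (l <= n)%N ->
    measurable_fun setT (Z k l : g_sigma_algebraType (G n) -> borel X).
  by apply: mZ; rewrite leqnn leqnSn.
have mY n l : (l <= n)%N ->
    measurable_fun setT (Z k.+1 l : g_sigma_algebraType (G n) -> borel X).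
  by apply: mZ; rewrite leqnn leqnSn.
have step_law n B A : <<s G n >> B -> measurable A ->
    Pr (B `&` Z k n.+1 @^-1` A) =
    (\int[Pr]_(w in B) estep upsilon (P k)
       (accept pi ((Temp k)^-1 - (Temp k.+1)^-1)) n (Z k.+1 ^~ w) (Z k n w)
       (fun x => (\1_A x)%:E))%E.
  move=> GB mA; rewrite (Z_tempering kK GB mA).
  by apply: eq_integral => w _; rewrite tempering_stepE.
have driftP s : 0 < s < (Temp k)^-1 -> exists lam b : R, 0 < lam < 1 /\
    forall x, (\int[P k x]_y (weight pi s y)%:E <= (lam * weight pi s x + b)%:E)%E.
  move=> hs; have [c c0 [lam [b [lam01 hP]]]] := P_drift kK hs.
  exists lam, (b / c); split => // x.
  have mW : measurable_fun setT (fun y : borel X => (weight pi s y)%:E).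
    by apply/measurable_EFinP; exact: measurable_weight.
  have := hP x; under eq_integral do rewrite EFinM.
  rewrite ge0_integralZl//; last 2 first.
    by move=> y _; rewrite lee_fin weight_ge0.
    by rewrite lee_fin ltW.
  rewrite muleC -lee_pdivlMr// -EFinM => /le_trans; apply.
  rewrite lee_fin le_eqVlt; apply/orP; left; apply/eqP.
  by rewrite /weight; field; rewrite gt_eqF.
split.
  exact: (lower_moments pi_cont pi0 t_gt0 te' e'e upsilon01 driftP Gm mX mY
    step_law momY (Z0_moment kK)).
move=> s f hs cf fC.
exact: (lln_weighted pi_cont pi0 piM pi1 t_gt0 tail kte' te' e'e upsilon01
  (P_feller kK) (P_invariant kK) driftP Gm Gmono mX mY step_law llnY momY
  (Z0_moment kK) hs cf fC).
Qed.

Lemma descend_levels : level_moments K -> level_lln K ->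
  forall j, (j < K)%N -> level_moments (K - j)%N /\ level_lln (K - j)%N.
Proof.
move=> momK llnK; elim=> [|j ih] jK; first by rewrite subn0.
have [m l] := ih (ltnW jK).
have e : (K - j)%N = (K - j.+1).+1 by rewrite subnSK// ltnW.
rewrite e in m l; apply: level_step => //.
by rewrite subn_gt0 jK/= ltn_subrL (leq_ltn_trans _ jK).
Qed.

End levels.

Theorem theorem3p6 (R : realType) (X : ptopologicalType)
    (mu : {measure set (borel X) -> \bar R}) (pi : X -> R)
    (K : nat) (Temp : nat -> R) (Tstar Ttilde upsilon : R)
    (P : nat -> R.-pker borel X ~> borel X)
    (d : measure_display) (Omega : measurableType d)
    (Pr : probability Omega R) (Z : nat -> nat -> {RV Pr >-> borel X})
    (X_polish : polish R X)
    (pi_density : density mu pi)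
    (pi_continuous : continuous pi)
    (pi_gt0 : forall x, 0 < pi x)
    (pi_bounded : (sup_norm pi < +oo)%E)
    (Tstar_gt1 : 1 < Tstar)
    (K_gt0 : (0 < K)%N)
    (Temp1 : Temp 1%N = 1)
    (Temp_increasing : forall i, (1 <= i < K)%N -> Temp i < Temp i.+1)
    (TempK : Temp K < Tstar)
    (P_irreducible :
       forall i, (1 <= i < K)%N -> irreducible_kernel mu pi (P i))
    (P_feller : forall i, (1 <= i < K)%N -> feller (P i))
    (P_invariant : forall i, (1 <= i < K)%N ->
       invariant_density mu (tempered mu pi (Temp i)) (P i))
    (P_drift : forall i, (1 <= i < K)%N ->
       forall s : R, 0 < s < (Temp i)^-1 ->
         exists2 c : R, 0 < c &
           drift_condition (P i) (fun x => c * pi x `^ (- s)))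
    (upsilon01 : 0 < upsilon < 1)
    (Z_tempering : interacting_tempering upsilon P pi Temp K Z)
    (Ttilde_bounds : Temp K < Ttilde < Tstar)
    (integrable_tail :
       (\int[mu]_x (pi x `^ ((Temp K)^-1 - Ttilde^-1))%:E < +oo)%E)
    (ZK_lln : forall f : X -> R, continuous f ->
       (ereal_sup (range (fun x => (`|f x| * pi x `^ Ttilde^-1)%:E)) < +oo)%E ->
       {ae Pr, forall w,
         n%:R^-1 * \sum_(1 <= k < n.+1) f (Z K k w) @[n --> \oo] -->
           \int[mu]_x (f x * tempered mu pi (Temp K) x)})
    (ZK_moment :
       (ereal_sup (range (fun n : nat =>
          'E_Pr[(fun w => pi (Z K n w) `^ (- Ttilde^-1))%R])) < +oo)%E)
    (Z0_moment : forall i, (1 <= i < K)%N ->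
       ('E_Pr[(fun w => pi (Z i 0%N w) `^ (- Ttilde^-1))%R] < +oo)%E) :
  forall f : X -> R, continuous f ->
    (ereal_sup (range (fun x => (`|f x| * pi x `^ Tstar^-1)%:E)) < +oo)%E ->
    {ae Pr, forall w,
      n%:R^-1 * \sum_(1 <= k < n.+1) f (Z 1%N k w) @[n --> \oo] -->
        \int[mu]_x (f x * pi x)}.
Proof.
have [M piM] : exists M : R, forall x, pi x <= M.
  have s0 : (0 <= sup_norm pi)%E.
    apply: (@le_trans _ _ `|pi point|%:E); first by rewrite lee_fin.
    by apply: ereal_sup_ubound; exists point.
  exists (fine (sup_norm pi)) => x.
  rewrite -lee_fin fineK ?ge0_fin_numE//.
  apply: (@le_trans _ _ `|pi x|%:E); first by rewrite lee_fin ler_norm.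
  by apply: ereal_sup_ubound; exists x.
have /andP[TtK Tts] := Ttilde_bounds.
have TempK1 : 1 <= Temp K <= Temp K.
  by apply: (Temp_bounds Temp1 Temp_increasing); rewrite K_gt0/=.
have Tt0 : 0 < Ttilde by case/andP: TempK1 => ? _; lra.
have Ts0 : 0 < Tstar by lra.
have t_gt0 : 0 < Ttilde^-1 by rewrite invr_gt0.
have sup_finite (I : Type) (F : I -> \bar R) (i : I) :
    (forall j, 0 <= F j)%E -> (ereal_sup (range F) < +oo)%E ->
    exists C : R, forall j, (F j <= C%:E)%E.
  move=> F0 Fsup.
  have h0 : (0 <= ereal_sup (range F))%E.
    by apply: le_trans (F0 i) _; apply: ereal_sup_ubound; exists i.
  exists (fine (ereal_sup (range F))) => j; rewrite fineK ?ge0_fin_numE//.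
  by apply: ereal_sup_ubound; exists j.
have momK : level_moments pi Ttilde Z K.
  have [|C hC] := @sup_finite nat _ 0%N _ ZK_moment.
    move=> n; rewrite unlock; apply: integral_ge0 => w _.
    by rewrite lee_fin powR_ge0.
  by exists C => n; have := hC n; rewrite unlock.
have llnK : level_lln mu pi Temp Ttilde Z K.
  move=> s f /andP[s0 st] cf [C fC].
  have C0 : 0 <= C.
    by have := le_trans (normr_ge0 _) (fC point); rewrite pmulr_lge0// powR_gt0.
  have f_tilde : (ereal_sup (range (fun x =>
      (`|f x| * pi x `^ Ttilde^-1)%:E)) < +oo)%E.
    apply: (@le_lt_trans _ _ (C * M `^ (Ttilde^-1 - s))%:E); last exact: ltry.
    apply: ge_ereal_sup => _ [x _ <-]; rewrite lee_fin.
    have := le_trans (fC x)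
      (ler_wpM2l C0 (weight_le pi_gt0 piM x (ltW st))).
    rewrite mulrA -ler_pdivrMr ?powR_gt0// /weight powRN invrK.
    exact.
  have := ZK_lln f cf f_tilde; apply: filterS => w.
  exact: (cvg_empirical (fun n => Z K n w) f _).1.
have Z0_moment' i : (1 <= i < K)%N ->
    (\int[Pr]_w (weight pi Ttilde^-1 (Z i 0%N w))%:E < +oo)%E.
  by move=> iK; have := Z0_moment i iK; rewrite unlock.
have [] := descend_levels pi_density pi_continuous pi_gt0 piM Temp1
  Temp_increasing P_feller P_invariant P_drift upsilon01 Z_tempering TtK
  integrable_tail Z0_moment' momK llnK (j := K.-1).
  by rewrite ltn_predL.
have -> : (K - K.-1)%N = 1%N by rewrite -subn1 subKn.
move=> _ lln1 f cf f_star.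
have [|C hC] := @sup_finite X _ point _ f_star.
  by move=> x; rewrite lee_fin mulr_ge0// powR_ge0.
have s_t : 0 < Tstar^-1 < Ttilde^-1.
  by rewrite invr_gt0 Ts0/= ltf_pV2 ?posrE.
have fC : exists C, forall x : borel X, `|f x| <= C * weight pi Tstar^-1 x.
  exists C => x; have := hC x; rewrite lee_fin /weight powRN.
  by rewrite -ler_pdivlMr// powR_gt0.
have := lln1 Tstar^-1 f s_t cf fC; apply: filterS => w.
have -> : \int[mu]_x (f x * gibbs mu pi (Temp 1%N)^-1 x) =
    \int[mu]_x (f x * pi x).
  have [_ _ pi1] := pi_density.
  apply: eq_Rintegral => x _; congr (_ * _).
  rewrite /gibbs Temp1 invr1.
  have -> : \int[mu]_y (pi y `^ 1) = 1.
    rewrite /Rintegral (_ : (fun y => _) = (fun y => (pi y)%:E)) ?pi1//.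
    by apply/funext => y; rewrite powRr1// ltW.
  by rewrite divr1 powRr1// ltW.
exact: (cvg_empirical (fun n => Z 1%N n w) f _).2.
Qed.
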